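(* For $\kappa$ small enough (i.e. there is $\kappa_0>0$, depending only on $\Omega,\ell,\zeta$, such that the following holds for all $\kappa\in(0,\kappa_0)$), the following problem ($P_{\mathrm d}$, the dual problem) with data $\tilde{\boldsymbol e},\tilde{\boldsymbol s}\in[L^2(\Omega)]^{d}$ and $q\in L^2(\Omega)$ is well posed: find $\boldsymbol x=(\boldsymbol y,\boldsymbol z)\in X_{\mathrm d}=Y_{\mathrm d}\times Z_{\mathrm d}$, with $\boldsymbol y=(u,\boldsymbol e,\boldsymbol s)$ and $\boldsymbol z=(\lambda,\boldsymbol\mu)$, such that $$a_{\mathrm d}(\boldsymbol y,\delta\boldsymbol y)+b_{\mathrm d}(\delta\boldsymbol y,\boldsymbol z)=(\tilde{\boldsymbol e},\delta\boldsymbol e)+\kappa(\tilde{\boldsymbol s},\delta\boldsymbol s)\quad\forall\,\delta\boldsymbol y=(\delta u,\delta\boldsymbol e,\delta\boldsymbol s)\in Y_{\mathrm d},$$ $$b_{\mathrm d}(\boldsymbol y,\delta\boldsymbol z)=(q,\delta\lambda)\quad\forall\,\delta\boldsymbol z=(\delta\lambda,\delta\boldsymbol\mu)\in Z_{\mathrm d}.$$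
   Context: $\Omega\subset\mathbb R^{d}$, $d\in\{2,3\}$, is a bounded connected open set with Lipschitz boundary; $(\cdot,\cdot)$ and $\|\cdot\|$ are the $L^2(\Omega)$ inner product and norm (scalar or vector valued). The reaction coefficient $\zeta>0$, the scale parameter $\kappa>0$ and the characteristic length $\ell>0$ of $\Omega$ are constants. $H_0(\mathrm{div},\Omega)$ is the space of fields in $[L^2(\Omega)]^d$ with divergence in $L^2(\Omega)$ and vanishing normal trace on $\partial\Omega$. $Y_{\mathrm d}=L^2(\Omega)\times[L^2(\Omega)]^d\times H_0(\mathrm{div},\Omega)$ (elements $\boldsymbol y=(u,\boldsymbol e,\boldsymbol s)$), with norm $\|\boldsymbol y\|_{Y_{\mathrm d}}^2=\ell^{-2}\|u\|^2+\|\boldsymbol e\|^2+\kappa\|\boldsymbol s\|^2+\kappa\ell^2\|\nabla\cdot\boldsymbol s\|^2$. $Z_{\mathrm d}=L^2(\Omega)\times H_0(\mathrm{div},\Omega)$ (elements $\boldsymbol z=(\lambda,\boldsymbol\mu)$), with norm $\|\boldsymbol z\|_{Z_{\mathrm d}}^2=\kappa^{-1}\ell^{-2}\|\lambda\|^2+\|\boldsymbol\mu\|^2+\ell^2\|\nabla\cdot\boldsymbol\mu\|^2$. For $\boldsymbol y_i=(u_i,\boldsymbol e_i,\boldsymbol s_i)\in Y_{\mathrm d}$: $a_{\mathrm d}(\boldsymbol y_1,\boldsymbol y_2)=(\boldsymbol e_1,\boldsymbol e_2)+\kappa(\boldsymbol s_1,\boldsymbol s_2)$. For $\boldsymbol y\in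 Y_{\mathrm d}$, $\boldsymbol z\in Z_{\mathrm d}$: $b_{\mathrm d}(\boldsymbol y,\boldsymbol z)=(\lambda,\nabla\cdot\boldsymbol s+\zeta u)+(\boldsymbol\mu,\boldsymbol e)+(\nabla\cdot\boldsymbol\mu,u)$. ''Well posed'' means: for all data $(\tilde{\boldsymbol e},\tilde{\boldsymbol s},q)$ there is exactly one solution, and it depends continuously on $(\tilde{\boldsymbol e},\tilde{\boldsymbol s},q)$. *)

(* Defs.v *)
From HB Require Import structures.
From mathcomp Require Import all_boot all_order all_algebra.
From mathcomp Require Import all_classical all_reals all_analysis.

Set Implicit Arguments.
Unset Strict Implicit.
Unset Printing Implicit Defensive.

Import Order.TTheory GRing.Theory Num.Theory.
Import numFieldNormedType.Exports.

Local Open Scope classical_set_scope.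
Local Open Scope ring_scope.

(* Rows carry the sigma-algebra generated by the coordinates, exactly as the
   library does for tuples; for real rows these are the Borel sets.           *)
Definition measure_row_display : measure_display -> measure_display.
Proof. exact. Qed.

Section measurable_row.
Context {d} {T : measurableType d}.
Variable n : nat.

Let coors : 'I_n -> 'rV[T]_n -> T := fun i x => x ord0 i.

Let row_set0 : g_sigma_preimage coors set0.
Proof. exact: sigma_algebra0. Qed.

Let row_setC A : g_sigma_preimage coors A -> g_sigma_preimage coors (~` A).
Proof. exact: sigma_algebraC. Qed.

Let row_bigcup (F : _^nat) : (forall i, g_sigma_preimage coors (F i)) ->
  g_sigma_preimage coors (\bigcup_i (F i)).
Proof. exact: sigma_algebra_bigcup. Qed.

HB.instance Definition _ := @isMeasurable.Build (measure_row_display d)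
  'rV[T]_n (g_sigma_preimage coors) row_set0 row_setC row_bigcup.

End measurable_row.

Lemma measurable_coord d (T : measurableType d) n (i : 'I_n) :
  measurable_fun [set: 'rV[T]_n] (fun x => x ord0 i).
Proof.
move=> _ Y mY; rewrite setTI; apply: sub_sigma_algebra => /=.
rewrite -bigcup_seq/=; exists i => /=; first by rewrite mem_index_enum.
by exists Y => //; rewrite setTI.
Qed.

Lemma measurable_fun_coordP d1 d2 (T1 : measurableType d1)
    (T2 : measurableType d2) n (f : T1 -> 'rV[T2]_n) :
  measurable_fun [set: T1] f <->
  forall i, measurable_fun [set: T1] (fun x => f x ord0 i).
Proof.
split=> [mf i|mf].
  exact: (measurableT_comp (@measurable_coord _ T2 n i) mf).
move=> _ A mA; rewrite setTI.
pose F := image_set_system setT f (@measurable _ T1).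
suff : F A by rewrite /F /image_set_system /= setTI.
apply: mA; split.
  apply: sigma_algebra_image; exact: sigma_algebra_measurable.
rewrite -bigcup_seq => _ [i _ [B mB <-]].
by rewrite /F /image_set_system /= !setTI -[X in measurable X]setTI; exact: mf.
Qed.

Section cons_measure.
Context {d} {T : measurableType d} {R : realType} (n : nat).
Variable m1 : {sigma_finite_measure set T -> \bar R}.
Variable m2 : {sigma_finite_measure set 'rV[T]_n -> \bar R}.

Definition row_cons (p : T * 'rV[T]_n) : 'rV[T]_n.+1 :=
  row_mx (const_mx p.1 : 'rV[T]_1) p.2.

Let row_consl p : row_cons p ord0 ord0 = p.1.
Proof.
rewrite (_ : ord0 = lshift n ord0 :> 'I_(1 + n)); last exact/val_inj.
by rewrite (@row_mxEl _ _ 1 n) mxE.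
Qed.

Let row_consr p i : row_cons p ord0 (rshift 1 i) = p.2 ord0 i.
Proof. exact: (@row_mxEr _ _ 1 n). Qed.

Lemma measurable_row_cons : measurable_fun [set: _] row_cons.
Proof.
apply/measurable_fun_coordP => i.
have [j ->|j ->] := @split_ordP 1 n i.
- rewrite (_ : (fun _ => _) = fst); first exact: measurable_fst.
  by apply/funext => p; rewrite [j]ord1 -row_consl; congr (row_cons _ _ _); exact/val_inj.
- rewrite (_ : (fun _ => _) = (fun x : 'rV[T]_n => x ord0 j) \o snd).
    exact: (measurableT_comp (@measurable_coord _ _ n j) measurable_snd).
  by apply/funext => p; exact: row_consr.
Qed.

Let mpre A : measurable A -> measurable (row_cons @^-1` A).
Proof.
by move=> mA; rewrite -[X in measurable X]setTI; exact: measurable_row_cons.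
Qed.

Definition cons_measure : set 'rV[T]_n.+1 -> \bar R :=
  pushforward (m1 \x m2)%E row_cons.

Let cons_measure0 : cons_measure set0 = 0%E.
Proof. by rewrite /cons_measure /pushforward preimage_set0 measure0. Qed.

Let cons_measure_ge0 A : (0 <= cons_measure A)%E.
Proof. by rewrite /cons_measure /pushforward measure_ge0. Qed.

Let cons_measure_sigma_additive : semi_sigma_additive cons_measure.
Proof.
move=> F mF tF mUF; rewrite /cons_measure /pushforward preimage_bigcup.
apply: measure_semi_sigma_additive.
- by move=> k; exact: mpre.
- apply/trivIsetP => i j _ _ ij; rewrite -preimage_setI.
  by move/trivIsetP : tF => /(_ _ _ _ _ ij) ->//; rewrite preimage_set0.
- by rewrite -preimage_bigcup; exact: mpre.
Qed.

HB.instance Definition _ := isMeasure.Build _ _ _ cons_measure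
  cons_measure0 cons_measure_ge0 cons_measure_sigma_additive.

Let cons_measure_sigma_finite : sigma_finite [set: 'rV[T]_n.+1] cons_measure.
Proof.
have /sigma_finiteP[F [FT ndF Foo]] := sigma_finiteT m1.
have /sigma_finiteP[G [GT ndG Goo]] := sigma_finiteT m2.
pose unc (x : 'rV[T]_n.+1) : T * 'rV[T]_n :=
  (x ord0 ord0, \row_j x ord0 (rshift 1 j)).
have munc : measurable_fun [set: _] unc.
  apply: measurable_fun_pair; first exact: measurable_coord.
  apply/measurable_fun_coordP => i.
  rewrite (_ : (fun _ => _) = (fun x : 'rV[T]_n.+1 => x ord0 (rshift 1 i))).
    exact: measurable_coord.
  by apply/funext => p; rewrite mxE.
have uncK p : unc (row_cons p) = p.
  case: p => a v; rewrite /unc row_consl; congr pair.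
  by apply/rowP => j; rewrite mxE row_consr.
exists (fun k => unc @^-1` (F k `*` G k)).
  rewrite -preimage_bigcup (_ : \bigcup_i _ = setT) ?preimage_setT//.
  apply/seteqP; split => // -[x y] _.
  have [i _ Fx] : (\bigcup_i F i) x by rewrite -FT.
  have [j _ Gy] : (\bigcup_i G i) y by rewrite -GT.
  exists (maxn i j) => //; split => /=.
    by move: x Fx; exact/subsetPset/ndF/leq_maxl.
  by move: y Gy; exact/subsetPset/ndG/leq_maxr.
move=> k; have [mF Fk] := Foo k; have [mG Gk] := Goo k.
have mFG : measurable (F k `*` G k) by exact: measurableX.
split; first by rewrite -[X in measurable X]setTI; exact: munc.
rewrite /cons_measure /pushforward (_ : _ @^-1` _ = F k `*` G k).
  by rewrite product_measure1E// lte_mul_pinfty// ge0_fin_numE.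
by apply/funext => p; rewrite -[RHS]/((F k `*` G k) p) -[in RHS](uncK p).
Qed.

HB.instance Definition _ :=
  Measure_isSigmaFinite.Build _ _ _ cons_measure cons_measure_sigma_finite.

End cons_measure.

Section lebesgue_row.
Context {R : realType}.

(* lebesgue_measure is declared on the alias measurableTypeR R; this is the
   same set function on R itself, whose measurable sets are the same.         *)
Definition lebesgue_measure1 : set R -> \bar R := @lebesgue_measure R.

HB.instance Definition _ := @isMeasure.Build _ R _ lebesgue_measure1
  (measure0 (@lebesgue_measure R)) (measure_ge0 (@lebesgue_measure R))
  (@measure_semi_sigma_additive _ _ _ (@lebesgue_measure R)).

HB.instance Definition _ := @Measure_isSigmaFinite.Build _ R _
  lebesgue_measure1 (sigma_finiteT (@lebesgue_measure R)).

Fixpoint lebesgue_row n : {sigma_finite_measure set 'rV[R]_n -> \bar R} :=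
  match n with
  | 0 => \d_(0 : 'rV[R]_0)
  | n'.+1 => cons_measure lebesgue_measure1 (lebesgue_row n')
  end.

End lebesgue_row.

Section domain.
Context {R : realType} {d : nat}.
Local Notation Rd := 'rV[R]_d.

(* Near each boundary point, in some orthonormal system of coordinates centred
   there, Omega is the strict epigraph of a Lipschitz function of the other
   d - 1 coordinates.                                                          *)
Definition lipschitz_boundary (Omega : set Rd) : Prop :=
  forall x, (closure Omega `\` interior Omega) x ->
  exists (r : R) (Q : 'M[R]_d) (i : 'I_d) (gamma : 'rV[R]_d.-1 -> R),
    [/\ 0 < r, Q *m Q^T = 1%:M, lipschitz gamma &
        Omega `&` ball x r =
        [set y | gamma (col' i ((y - x) *m Q)) < ((y - x) *m Q) ord0 i]
          `&` ball x r].

Definition pderiv (i : 'I_d) (f : Rd -> R) : Rd -> R :=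
  'D_(delta_mx ord0 i) f.

Fixpoint Ck (k : nat) (f : Rd -> R) : Prop :=
  match k with
  | 0 => continuous f
  | k'.+1 => (forall x, differentiable f x) /\ (forall i, Ck k' (pderiv i f))
  end.

Definition test_function (Omega : set Rd) : set (Rd -> R) :=
  [set phi | (forall k, Ck k phi) /\
     exists2 K, compact K & K `<=` Omega /\ forall x, ~ K x -> phi x = 0].

Definition gradient (f : Rd -> R) (x : Rd) : Rd := \row_i pderiv i f x.

End domain.

Section function_spaces.
Context {R : realType} {d : nat}.
Local Notation Rd := 'rV[R]_d.
Local Notation leb := (lebesgue_row d).
Variable Omega : set Rd.

(* A function on Omega is represented by a total one whose values outside Omega
   are irrelevant, and a class of functions by any of its members: equality in
   L^2(Omega) is eqL2.                                                         *)
Local Notation sfield := (Rd -> R).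
Local Notation vfield := (Rd -> Rd).

Definition L2 : set sfield := [set f | f \_ Omega \in Lfun leb 2%:E].
Definition L2v : set vfield := [set s | forall i, L2 (fun x => s x ord0 i)].

Definition eqL2 (f g : sfield) : Prop := ae_eq leb Omega f g.
Definition eqL2v (s t : vfield) : Prop := ae_eq leb Omega s t.

Definition dot (v w : Rd) : R := \sum_i v ord0 i * w ord0 i.

Definition ip (f g : sfield) : R := (\int[leb]_(x in Omega) (f x * g x))%R.
Definition ipv (s t : vfield) : R := (\int[leb]_(x in Omega) dot (s x) (t x))%R.

Definition nrm (f : sfield) : R := Num.sqrt (ip f f).
Definition nrmv (s : vfield) : R := Num.sqrt (ipv s s).

Definition weak_gradient (v : sfield) (G : vfield) : Prop :=
  forall phi i, test_function Omega phi ->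
    ip v (pderiv i phi) = - ip (fun x => G x ord0 i) phi.

Definition weak_divergence (s : vfield) (g : sfield) : Prop :=
  forall phi, test_function Omega phi -> ipv s (gradient phi) = - ip g phi.

(* The weak derivatives are determined by the function up to a null set.
   Elements of the spaces below are therefore written as pairs: a function of
   H^1 with its gradient, a field of H(div) with its divergence.               *)
Definition sobolev_H1 : set (sfield * vfield) :=
  [set v | [/\ L2 v.1, L2v v.2 & weak_gradient v.1 v.2]].

Definition Hdiv : set (vfield * sfield) :=
  [set s | [/\ L2v s.1, L2 s.2 & weak_divergence s.1 s.2]].

(* The normal trace of s is, by Green's formula, the functional
   v |-> (s, grad v) + (div s, v) on the traces of H^1 functions.              *)
Definition normal_trace (s : vfield * sfield) (v : sfield * vfield) : R :=
  ipv s.1 v.2 + ip s.2 v.1.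

Definition H0div : set (vfield * sfield) :=
  [set s | Hdiv s /\ forall v, sobolev_H1 v -> normal_trace s v = 0].

End function_spaces.

(* For a problem "sol f x" with data f in D: eqX is the equality of unknowns, and
   the norms are the ones in which the solution depends continuously on f.     *)
Definition well_posed {R : realType} {F X : zmodType} (D : set F)
    (sol : F -> X -> Prop) (eqX : X -> X -> Prop)
    (normF : F -> R) (normX : X -> R) : Prop :=
  (forall f, D f -> exists2 x, sol f x & forall x', sol f x' -> eqX x x') /\
  (forall f x, D f -> sol f x -> forall eps : R, 0 < eps ->
     exists2 delta : R, 0 < delta &
       forall f' x', D f' -> sol f' x' -> normF (f' - f) < delta ->
         normX (x' - x) < eps).

Section dual_problem.
Context {R : realType} {d : nat}.
Variables (Omega : set 'rV[R]_d) (ell zeta kappa : R).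
Local Notation sfield := ('rV[R]_d -> R).
Local Notation vfield := ('rV[R]_d -> 'rV[R]_d).
(* (u, e, (s, div s)) *)
Local Notation Y := (sfield * vfield * (vfield * sfield))%type.
(* (lambda, (mu, div mu)) *)
Local Notation Z := (sfield * (vfield * sfield))%type.
(* (e~, s~, q) *)
Local Notation F := (vfield * vfield * sfield)%type.

Local Notation ip := (ip Omega).
Local Notation ipv := (ipv Omega).
Local Notation nrm := (nrm Omega).
Local Notation nrmv := (nrmv Omega).

Definition Yd : set Y :=
  [set y | [/\ L2 Omega y.1.1, L2v Omega y.1.2 & H0div Omega y.2]].

Definition Zd : set Z := [set z | L2 Omega z.1 /\ H0div Omega z.2].

Definition normYd (y : Y) : R :=
  let: (u, e, (s, divs)) := y in
  Num.sqrt (ell ^- 2 * nrm u ^+ 2 + nrmv e ^+ 2 + kappa * nrmv s ^+ 2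
            + kappa * ell ^+ 2 * nrm divs ^+ 2).

Definition normZd (z : Z) : R :=
  let: (lambda, (mu, divmu)) := z in
  Num.sqrt (kappa^-1 * ell ^- 2 * nrm lambda ^+ 2 + nrmv mu ^+ 2
            + ell ^+ 2 * nrm divmu ^+ 2).

Definition normXd (x : Y * Z) : R :=
  Num.sqrt (normYd x.1 ^+ 2 + normZd x.2 ^+ 2).

Definition eqXd (x x' : Y * Z) : Prop :=
  let: ((u, e, (s, divs)), (lambda, (mu, divmu))) := x in
  let: ((u', e', (s', divs')), (lambda', (mu', divmu'))) := x' in
  [/\ eqL2 Omega u u', eqL2v Omega e e', eqL2v Omega s s' /\
      eqL2 Omega divs divs', eqL2 Omega lambda lambda' &
      eqL2v Omega mu mu' /\ eqL2 Omega divmu divmu'].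

Definition a_d (y1 y2 : Y) : R :=
  let: (_, e1, (s1, _)) := y1 in
  let: (_, e2, (s2, _)) := y2 in
  ipv e1 e2 + kappa * ipv s1 s2.

Definition b_d (y : Y) (z : Z) : R :=
  let: (u, e, (s, divs)) := y in
  let: (lambda, (mu, divmu)) := z in
  ip lambda (fun x => divs x + zeta * u x) + ipv mu e + ip divmu u.

Definition data_d : set F :=
  [set f | [/\ L2v Omega f.1.1, L2v Omega f.1.2 & L2 Omega f.2]].

Definition norm_data_d (f : F) : R :=
  Num.sqrt (nrmv f.1.1 ^+ 2 + nrmv f.1.2 ^+ 2 + nrm f.2 ^+ 2).

Definition solution_d (f : F) (x : Y * Z) : Prop :=
  let: (et, st, q) := f in
  let: (y, z) := x in
  [/\ Yd y, Zd z,
      forall dy, Yd dy ->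
        a_d y dy + b_d dy z = ipv et dy.1.2 + kappa * ipv st dy.2.1 &
      forall dz, Zd dz -> b_d y dz = ip q dz.1].

End dual_problem.

(* Main.v *)
(* Eliminating u, e and lambda leaves a system for (s, mu) whose bilinear form
   has opposite off-diagonal couplings through the divergence; testing it with
   (s / kappa - mu, - mu / kappa - s) makes it coercive in H(div) x H(div) as
   soon as kappa < 1. Completing this test to all the unknowns gives an inf-sup
   condition for the full symmetric form. Existence then follows from the Riesz
   theorem applied twice, and uniqueness and continuity from the a priori bound.
   The Hilbert spaces are semi-inner product spaces of functions, not quotients;
   H_0(div) is complete because it is an orthogonal complement in
   L^2(Omega)^d x L^2(Omega). *)

From HB Require Import structures.
Require Import Defs.
From mathcomp Require Import all_boot all_order all_algebra.
From mathcomp Require Import all_classical all_reals all_analysis.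
From mathcomp Require Import measurable_realfun ring lra.

Set Implicit Arguments.
Unset Strict Implicit.
Unset Printing Implicit Defensive.

Import Order.TTheory GRing.Theory Num.Theory.
Import numFieldNormedType.Exports.

Local Open Scope classical_set_scope.
Local Open Scope ring_scope.

(** * Semi-inner product spaces *)

(** After elimination the form is kappa (s, s') - (mu, mu') - (1/zeta) (div mu, div s') - (1/zeta)
    (div s, div mu'): it is indefinite, and divergences occur only off the diagonal. Testing with
    (s, - mu) cancels them and leaves only L^2 norms; testing with (- mu, - s) produces both squared
    divergences, at the price of the cross term (1 - kappa) (s, mu). The weight 1/kappa on the first
    test yields |s|^2 + |mu|^2 / kappa, which absorbs that cross term. The completion to all
    unknowns is exact: in the residuals e + mu, lambda + div mu / zeta and u + div s / zeta, the
    full form is the reduced one plus a square-type pairing of the first residual and zeta times a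
    crossed pairing of the other two, so the test keeps the first and exchanges the others.
    Estimates are made in unweighted norms, with constants depending on kappa and zeta; the weights
    [ell] and [kappa] return when the norm of the solution is finally bounded. *)

Section subspace.
Context {R : realType}.

(** Bundling a set with its closure proof lets [sub_of] inherit a linear structure, so that spaces
    given by analytic conditions become genuine [lmodType]s. *)
Record subspace (V : lmodType R) := Subspace {
  subspace_set :> set V;
  subspaceP : submod_closed [pred x | x \in subspace_set] }.

Definition in_subspace (V : lmodType R) (S : subspace V) : {pred V} :=
  [pred x | x \in subspace_set S].

HB.instance Definition _ V (S : subspace V) :=
  GRing.isSubmodClosed.Build R V (in_subspace S) (subspaceP S).

Record sub_of (V : lmodType R) (S : subspace V) :=
  SubOf { sub_val : V; _ : sub_val \in in_subspace S }.

HB.instance Definition _ V (S : subspace V) := [isSub for @sub_val V S].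
HB.instance Definition _ V (S : subspace V) := [Choice of sub_of S by <:].
HB.instance Definition _ V (S : subspace V) :=
  [SubChoice_isSubLmodule of sub_of S by <:].

Lemma sub_of_in V (S : subspace V) (x : sub_of S) : subspace_set S (sub_val x).
Proof. exact: set_mem (valP x). Qed.

Lemma sub_of_ex V (S : subspace V) (x : V) :
  subspace_set S x -> {y : sub_of S | sub_val y = x}.
Proof.
move=> Sx; have xS : x \in in_subspace S by exact: mem_set.
by exists (SubOf xS).
Qed.

Lemma sub_valP V (S : subspace V) a (x y : sub_of S) :
  sub_val (a *: x + y) = a *: sub_val x + sub_val y.
Proof. exact: (linearP val). Qed.

Lemma sub_valB V (S : subspace V) (x y : sub_of S) :
  sub_val (x - y) = sub_val x - sub_val y.
Proof. exact: (linearB val). Qed.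

Lemma sub_val0 V (S : subspace V) : sub_val (0 : sub_of S) = 0.
Proof. exact: (linear0 val). Qed.

End subspace.

(** The case c = 0 matters: in a semi-inner product space a nonzero direction may have zero length.
    The bound serves both for Cauchy-Schwarz and for the approximate Euler equation in [riesz]. *)
Lemma discriminant_bound (R : realType) (a b c : R) :
  0 <= c -> (forall t, 0 <= a + 2 * t * b + t ^+ 2 * c) -> b ^+ 2 <= a * c.
Proof.
move=> /[!le0r]/predU1P[->|c0] h.
  rewrite mulr0; suff -> : b = 0 by rewrite expr0n.
  (* For c = 0 the polynomial is affine in [t]; at this point its value is -1. *)
  apply/eqP/negPn/negP => b0; have := h (- (a + 1) / (2 * b)).
  have -> : 2 * (- (a + 1) / (2 * b)) * b = - (a + 1) by field.
  lra.
have := h (- b / c).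
have -> : a + 2 * (- b / c) * b + (- b / c) ^+ 2 * c = (a * c - b ^+ 2) / c.
  by field; rewrite gt_eqF.
by rewrite pmulr_lge0 ?invr_gt0// subr_ge0.
Qed.

Section sip.
Context {R : realType}.

Record sip (V : lmodType R) := Sip {
  sip_form :> V -> V -> R;
  sipC : forall x y, sip_form x y = sip_form y x;
  sipPl : forall a x y z,
    sip_form (a *: x + y) z = a * sip_form x z + sip_form y z;
  sip_ge0 : forall x, 0 <= sip_form x x }.

Section theory.
Context {V : lmodType R} (g : sip V).

Lemma sipDl x y z : g (x + y) z = g x z + g y z.
Proof. by rewrite -[x in LHS]scale1r sipPl mul1r. Qed.
Lemma sip0l z : g 0 z = 0.
Proof. by have /eqP := sipDl 0 0 z; rewrite addr0 -subr_eq subrr => /eqP. Qed.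
Lemma sipZl a x z : g (a *: x) z = a * g x z.
Proof. by rewrite -[_ *: _]addr0 sipPl sip0l addr0. Qed.
Lemma sipNl x z : g (- x) z = - g x z.
Proof. by rewrite -scaleN1r sipZl mulN1r. Qed.
Lemma sipBl x y z : g (x - y) z = g x z - g y z.
Proof. by rewrite sipDl sipNl. Qed.
Lemma sipDr x y z : g z (x + y) = g z x + g z y.
Proof. by rewrite sipC sipDl ![g _ z]sipC. Qed.
Lemma sip0r z : g z 0 = 0. Proof. by rewrite sipC sip0l. Qed.
Lemma sipZr a x z : g z (a *: x) = a * g z x.
Proof. by rewrite sipC sipZl sipC. Qed.
Lemma sipNr x z : g z (- x) = - g z x.
Proof. by rewrite sipC sipNl sipC. Qed.
Definition sipE := (sipDl, sipDr, sipNl, sipNr, sipZl, sipZr, sip0l, sip0r).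


Lemma sip_CS x y : g x y ^+ 2 <= g x x * g y y.
Proof.
apply: discriminant_bound => [|t]; first exact: sip_ge0.
by have := sip_ge0 g (x + t *: y); rewrite !sipE [g y x]sipC; lra.
Qed.

Lemma sip_eq0 x y : g x x = 0 -> g x y = 0.
Proof.
move=> x0; apply/eqP; rewrite -sqrf_eq0 eq_le sqr_ge0 andbT.
by rewrite (le_trans (sip_CS _ _))// x0 mul0r.
Qed.

Lemma sip_sqD x y : g (x + y) (x + y) <= 2 * g x x + 2 * g y y.
Proof. by have := sip_ge0 g (x - y); rewrite !sipE [g y x]sipC; lra. Qed.

Definition sip_cauchy (u : nat -> V) := forall e : R, 0 < e ->
  exists N, forall m n, (N <= m)%N -> (N <= n)%N -> g (u m - u n) (u m - u n) < e.

Definition sip_cvg (u : nat -> V) (l : V) := forall e : R, 0 < e ->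
  exists N, forall n, (N <= n)%N -> g (u n - l) (u n - l) < e.

Definition sip_complete := forall u, sip_cauchy u -> exists l, sip_cvg u l.

Definition linear_form (F : V -> R) := forall a x y, F (a *: x + y) = a * F x + F y.

Definition bounded_form (F : V -> R) := exists2 C : R, 0 <= C &
  forall x, F x ^+ 2 <= C * g x x.

End theory.
End sip.

(** * Linear forms, the Riesz theorem and symmetric inf-sup problems *)

Lemma linear_formD (R : realType) (V : lmodType R) (F : V -> R) :
  linear_form F -> {morph F : x y / x + y}.
Proof. by move=> lF x y; rewrite -[x in LHS]scale1r lF mul1r. Qed.

Lemma linear_form0 (R : realType) (V : lmodType R) (F : V -> R) :
  linear_form F -> F 0 = 0.
Proof. by move=> /linear_formD /(_ 0 0) /eqP; rewrite addr0 -subr_eq subrr => /eqP. Qed.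

Lemma linear_formZ (R : realType) (V : lmodType R) (F : V -> R) a x :
  linear_form F -> F (a *: x) = a * F x.
Proof. by move=> lF; rewrite -[_ *: _]addr0 lF linear_form0// addr0. Qed.

(* The functional [x |-> g x x - 2 F x] is bounded below; a minimising sequence
   is Cauchy by the parallelogram identity. *)
Lemma riesz (R : realType) (V : lmodType R) (g : sip V) (F : V -> R) :
  sip_complete g -> linear_form F -> bounded_form g F ->
  exists k, forall w, g k w = F w.
Proof.
move=> cg lF [C C0 bF].
have FD := linear_formD lF; have FZ a x : F (a *: x) = a * F x := linear_formZ a x lF.
pose J x := g x x - 2 * F x.
have Jlb x : - (C + 1) <= J x.
  (* [C + 1] is a positive factor even if [C] is 0; multiplied by it, J x + (C + 1) dominates the
     square of C + 1 - F x. *)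
  have C1 : 0 < C + 1 by lra.
  have {}bF : F x ^+ 2 <= (C + 1) * g x x.
    by rewrite (le_trans (bF x))// ler_wpM2r ?sip_ge0//; lra.
  rewrite -subr_ge0 -(pmulr_rge0 _ C1) /J.
  by have := sqr_ge0 (C + 1 - F x); nra.
have hi : has_inf (range J).
  split; first by exists (J 0), 0.
  by exists (- (C + 1)) => _ [x _ <-].
pose m := inf (range J).
have Jm x : m <= J x by apply: ge_inf; [case: hi|exists x].
have /choice [u uP] n : exists x, J x < m + n.+1%:R^-1.
  have n0 : 0 < n.+1%:R^-1 :> R by rewrite invr_gt0.
  by have [_ [x _ <-]] := inf_adherent n0 hi; exists x.
have uc : sip_cauchy g u.
  move=> e e0; have [N _ NP] :=
    near_infty_natSinv_lt (PosNum (divr_gt0 e0 (ltr0Sn R 3))).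
  exists N => p q Np Nq.
  have := Jm (2^-1 *: (u p + u q)).
  have := uP p; have := uP q; have /= := NP _ Np; have /= := NP _ Nq.
  rewrite /J !sipE !(FZ, FD) [g (u q) (u p)]sipC.
  by move: p.+1%:R^-1 q.+1%:R^-1 => rp rq; lra.
have [k uk] := cg _ uc; exists k => w.
(* Moving the near minimiser [u n] along [w] lowers [J] by at most 1/(n+1): this is the Euler
   equation up to an error that vanishes with n. *)
have almost n : (g (u n) w - F w) ^+ 2 <= n.+1%:R^-1 * g w w.
  pose b := g (u n) w - F w.
  have h t : 0 <= n.+1%:R^-1 + 2 * t * b + t ^+ 2 * g w w.
    have := Jm (u n + t *: w); have := uP n.
    rewrite /J /b !sipE !(FZ, FD) [g w (u n)]sipC.
    by move: n.+1%:R^-1 => r; lra.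
  exact: discriminant_bound (sip_ge0 _ _) h.
apply/eqP; rewrite -subr_eq0 -sqrf_eq0 eq_le sqr_ge0 andbT.
apply/ler_addgt0Pl => e e0; rewrite addr0.
pose e' := e / (2 * (g w w + 1)).
have w1 : 0 < g w w + 1 by have := sip_ge0 g w; lra.
have e'0 : 0 < e' by rewrite divr_gt0// mulr_gt0.
have [N1 _ N1P] := near_infty_natSinv_lt (PosNum (divr_gt0 e'0 (ltr0Sn R 1))).
have [N2 N2P] := uk _ (divr_gt0 e'0 (ltr0Sn R 1)).
pose n := maxn N1 N2.
have /= h1 := N1P n (leq_maxl _ _); have h2 := N2P n (leq_maxr _ _).
have h3 := almost n; have := sip_CS g (u n - k) w; rewrite sipBl => h4.
have h5 := sqr_ge0 ((g (u n) w - F w) + (g (u n) w - g k w)).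
have ee : e = 2 * (e' * g w w) + 2 * e' by rewrite /e'; field; lra.
have : n.+1%:R^-1 * g w w <= e' / 2 * g w w by rewrite ler_wpM2r ?sip_ge0// ltW.
have : g (u n - k) (u n - k) * g w w <= e' / 2 * g w w.
  by rewrite ler_wpM2r ?sip_ge0// ltW.
have := ltW e'0; move: h3 h4 h5 ee.
move: (g (u n) w) (g k w) (F w) (g w w) (n.+1%:R^-1) (g (u n - k) (u n - k)).
move=> ? ? ? ? ? ?.
by clear; lra.
Qed.

(** Operator bounds are stated for squared norms, here as in [bounded_form] and [bilinear_bounded],
    which keeps square roots out of the estimates. *)
Definition sip_cont (R : realType) (V V' : lmodType R) (g : sip V) (g' : sip V')
    (P : V -> V') :=
  exists2 M : R, 0 <= M & forall x, g' (P x) (P x) <= M * g x x.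

Definition bilinear_bounded (R : realType) (V : lmodType R) (g : sip V)
    (B : V -> V -> R) :=
  exists2 M : R, 0 <= M & forall x w, B x w ^+ 2 <= M * g x x * g w w.

(* With [K] the operator representing [B], the form [g (K x) (K w)] is an
   equivalent inner product, so that the least-squares problem for [K x = f] is
   solvable; symmetry of [K] makes its residual vanish. *)
Lemma symmetric_infsup (R : realType) (V : lmodType R) (g : sip V)
    (B : V -> V -> R) (T : V -> V) (c : R) (F : V -> R) :
  sip_complete g -> (forall x w, B x w = B w x) -> (forall x, linear_form (B x)) ->
  bilinear_bounded g B -> 0 <= c -> sip_cont g g T ->
  (forall x, g x x <= c * B x (T x)) -> linear_form F -> bounded_form g F ->
  exists x, forall w, B x w = F w.
Proof.
move=> cg BC lB [M M0 bB] c0 [K' K'0 bT] infsup lF bF.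
have /choice [K KP] x : exists k, forall w, g k w = B x w.
  apply: riesz => //; exists (M * g x x); first by rewrite mulr_ge0 ?sip_ge0.
  by move=> w; exact: bB.
have [f fP] := riesz cg lF bF.
have SC x y : g (K x) (K y) = g (K y) (K x) by rewrite sipC.
have SPl a x y z : g (K (a *: x + y)) (K z) = a * g (K x) (K z) + g (K y) (K z).
  by rewrite !KP BC lB ![B (K z) _]BC.
pose S := Sip SC SPl (fun x => sip_ge0 g (K x)).
have Sle x : S x x <= M * g x x.
  have [->|S0] := eqVneq (S x x) 0; first by rewrite mulr_ge0 ?sip_ge0.
  have Sp : 0 < S x x by rewrite lt_neqAle eq_sym S0 sip_ge0.
  by rewrite -(ler_pM2r Sp) -expr2; have := bB x (K x); rewrite -KP.
(* Since B x (T x) = g (K x) (T x), Cauchy-Schwarz in the squared inf-sup inequality leaves a factor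
   g x x on both sides, which is divided out. *)
have leS x : g x x <= c ^+ 2 * K' * S x x.
  have [g0|g0] := eqVneq (g x x) 0.
    by rewrite g0 mulr_ge0 ?sip_ge0 ?mulr_ge0 ?sqr_ge0.
  have gp : 0 < g x x by rewrite lt_neqAle eq_sym g0 sip_ge0.
  rewrite -(ler_pM2r gp) -expr2.
  have h1 : g x x ^+ 2 <= c ^+ 2 * B x (T x) ^+ 2.
    by rewrite -exprMn ler_sqr ?nnegrE ?infsup ?(le_trans (sip_ge0 g x))//.
  have h2 : B x (T x) ^+ 2 <= S x x * (K' * g x x).
    rewrite -KP (le_trans (sip_CS _ _ _))// ler_wpM2l ?sip_ge0//.
  rewrite (le_trans h1)//.
  have -> : c ^+ 2 * K' * S x x * g x x = c ^+ 2 * (S x x * (K' * g x x)) by ring.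
  by rewrite ler_wpM2l ?sqr_ge0.
have cS : sip_complete S.
  move=> u uc.
  have [|l ul] := cg u.
    move=> e e0; have C0 : 0 < c ^+ 2 * K' + 1.
      by rewrite ltr_wpDl// mulr_ge0 ?sqr_ge0.
    have [N NP] := uc _ (divr_gt0 e0 C0); exists N => p q Np Nq.
    have := NP _ _ Np Nq; rewrite ltr_pdivlMr// => h.
    rewrite (le_lt_trans _ h)// (le_trans (leS _))// mulrC ler_wpM2l ?sip_ge0//.
    by rewrite lerDl.
  exists l => e e0; have C0 : 0 < M + 1 by lra.
  have [N NP] := ul _ (divr_gt0 e0 C0); exists N => n Nn.
  have := NP _ Nn; rewrite ltr_pdivlMr// => h.
  rewrite (le_lt_trans _ h)// (le_trans (Sle _))// mulrC ler_wpM2l ?sip_ge0//.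
  by rewrite lerDl.
have [x xP] : exists x, forall w, S x w = B f w.
  apply: riesz => //; exists (g f f); first exact: sip_ge0.
  by move=> w; rewrite BC -KP sipC; exact: sip_CS.
have {}xP w : g (K x) (K w) = B f w := xP w.
(* The normal equations make [r] orthogonal to the range of [K]; by symmetry B r v = g r (K v) = 0
   for all v, and the inf-sup inequality at [r] gives g r r = 0. *)
exists x => w; pose r := K x - f.
have r0 : g r r = 0.
  have Br v : B r v = 0.
    by rewrite BC -KP sipC sipBl xP ![g f _]sipC KP BC subrr.
  by apply/eqP; rewrite eq_le sip_ge0 andbT (le_trans (infsup r))// Br mulr0.
rewrite -KP -fP; apply/eqP; rewrite -subr_eq0 -sipBl; apply/eqP; exact: sip_eq0.
Qed.

(** * Product spaces, bounded maps and bounded bilinear forms *)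

Section sip_prod.
Context {R : realType} {V1 V2 : lmodType R} (g1 : sip V1) (g2 : sip V2).

Definition prod_form (x y : V1 * V2) := g1 x.1 y.1 + g2 x.2 y.2.

Lemma prod_formC x y : prod_form x y = prod_form y x.
Proof. by rewrite /prod_form sipC [g2 _ _]sipC. Qed.

Lemma prod_formPl a x y z :
  prod_form (a *: x + y) z = a * prod_form x z + prod_form y z.
Proof. by rewrite /prod_form /= !sipPl; ring. Qed.

Lemma prod_form_ge0 x : 0 <= prod_form x x.
Proof. by rewrite addr_ge0 ?sip_ge0. Qed.

Definition sip_prod := Sip prod_formC prod_formPl prod_form_ge0.

Lemma sip_prodE x y : sip_prod x y = g1 x.1 y.1 + g2 x.2 y.2.
Proof. by []. Qed.

Lemma sip_prod_complete :
  sip_complete g1 -> sip_complete g2 -> sip_complete sip_prod.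
Proof.
move=> c1 c2 u uc.
have [|l1 h1] := c1 (fst \o u).
  move=> e e0; have [N NP] := uc _ e0; exists N => m n Nm Nn.
  by apply: le_lt_trans (NP _ _ Nm Nn); rewrite sip_prodE /= lerDl sip_ge0.
have [|l2 h2] := c2 (snd \o u).
  move=> e e0; have [N NP] := uc _ e0; exists N => m n Nm Nn.
  by apply: le_lt_trans (NP _ _ Nm Nn); rewrite sip_prodE /= lerDr sip_ge0.
exists (l1, l2) => e e0; have e2 : 0 < e / 2 by rewrite divr_gt0.
have [N1 N1P] := h1 _ e2; have [N2 N2P] := h2 _ e2.
exists (maxn N1 N2) => n; rewrite geq_max => /andP[n1 n2].
have := N1P _ n1; have := N2P _ n2; rewrite sip_prodE /=; lra.
Qed.

Lemma sip_cont_fst : sip_cont sip_prod g1 fst.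
Proof. by exists 1 => // x; rewrite mul1r sip_prodE lerDl sip_ge0. Qed.

Lemma sip_cont_snd : sip_cont sip_prod g2 snd.
Proof. by exists 1 => // x; rewrite mul1r sip_prodE lerDr sip_ge0. Qed.

End sip_prod.

Section bounded_maps.
Context {R : realType} {V V1 V2 : lmodType R} (g : sip V) (g1 : sip V1) (g2 : sip V2).

Lemma sip_cont_comp (P : V -> V1) (Q : V1 -> V2) :
  sip_cont g g1 P -> sip_cont g1 g2 Q -> sip_cont g g2 (fun x => Q (P x)).
Proof.
move=> [M M0 MP] [M' M'0 MQ]; exists (M' * M); first exact: mulr_ge0.
by move=> x; rewrite (le_trans (MQ _))// -mulrA ler_wpM2l.
Qed.

Lemma sip_cont_pair (P : V -> V1) (Q : V -> V2) :
  sip_cont g g1 P -> sip_cont g g2 Q ->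
  sip_cont g (sip_prod g1 g2) (fun x => (P x, Q x)).
Proof.
move=> [M M0 MP] [M' M'0 MQ]; exists (M + M'); first exact: addr_ge0.
by move=> x; rewrite sip_prodE mulrDl; exact: lerD (MP x) (MQ x).
Qed.

Lemma sip_contD (P Q : V -> V1) :
  sip_cont g g1 P -> sip_cont g g1 Q -> sip_cont g g1 (fun x => P x + Q x).
Proof.
move=> [M M0 MP] [M' M'0 MQ]; exists (2 * M + 2 * M') => [|x]; first lra.
have := sip_sqD g1 (P x) (Q x); have := MP x; have := MQ x; lra.
Qed.

Lemma sip_contZ a (P : V -> V1) :
  sip_cont g g1 P -> sip_cont g g1 (fun x => a *: P x).
Proof.
move=> [M M0 MP]; exists (a ^+ 2 * M) => [|x]; first by rewrite mulr_ge0 ?sqr_ge0.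
by rewrite sipZl sipZr mulrA -expr2 -(mulrA (a ^+ 2) M) ler_wpM2l ?sqr_ge0.
Qed.

Lemma sip_contN (P : V -> V1) :
  sip_cont g g1 P -> sip_cont g g1 (fun x => - P x).
Proof.
by move=> [M M0 MP]; exists M => // x; rewrite sipNl sipNr opprK.
Qed.

Lemma bilinear_bounded_sip (P Q : V -> V1) :
  sip_cont g g1 P -> sip_cont g g1 Q ->
  bilinear_bounded g (fun x w => g1 (P x) (Q w)).
Proof.
move=> [M M0 MP] [M' M'0 MQ]; exists (M * M') => [|x w]; first exact: mulr_ge0.
rewrite (le_trans (sip_CS _ _ _))//.
by rewrite (_ : _ * _ * _ * _ = (M * g x x) * (M' * g w w)) ?ler_pM ?sip_ge0//; ring.
Qed.

Lemma bilinear_boundedD (B B' : V -> V -> R) :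
  bilinear_bounded g B -> bilinear_bounded g B' ->
  bilinear_bounded g (fun x w => B x w + B' x w).
Proof.
move=> [M M0 MP] [M' M'0 MQ]; exists (2 * M + 2 * M') => [|x w]; first lra.
have := MP x w; have := MQ x w; have := sqr_ge0 (B x w - B' x w); nra.
Qed.

Lemma bilinear_boundedZ a (B : V -> V -> R) :
  bilinear_bounded g B -> bilinear_bounded g (fun x w => a * B x w).
Proof.
move=> [M M0 MP]; exists (a ^+ 2 * M) => [|x w].
  by rewrite mulr_ge0 ?sqr_ge0.
by rewrite exprMn -(mulrA (a ^+ 2) M) -(mulrA (a ^+ 2)) ler_wpM2l ?sqr_ge0.
Qed.

Lemma bilinear_boundedC (B : V -> V -> R) :
  bilinear_bounded g B -> bilinear_bounded g (fun x w => B w x).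
Proof.
by move=> [M M0 MP]; exists M => // x w; rewrite (le_trans (MP w x))// mulrAC.
Qed.

End bounded_maps.

(** * Orthogonal complements and their completeness *)

Section perp.
Context {R : realType} {V : lmodType R} (g : sip V).

Lemma perp_submod (N : set V) :
  submod_closed [pred x | x \in [set x | forall n, N n -> g x n = 0]].
Proof.
split=> [|a x y].
  by apply: mem_set => n _; rewrite sip0l.
move=> /set_mem hx /set_mem hy; apply: mem_set => n Nn.
by rewrite sipPl hx// hy// mulr0 addr0.
Qed.

Definition perp (N : set V) : subspace V := Subspace (perp_submod N).

Variable S : subspace V.

Definition sub_form (x y : sub_of S) := g (sub_val x) (sub_val y).

Lemma sub_formC x y : sub_form x y = sub_form y x. Proof. exact: sipC. Qed.

Lemma sub_formPl a x y z :
  sub_form (a *: x + y) z = a * sub_form x z + sub_form y z.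
Proof. by rewrite /sub_form sub_valP sipPl. Qed.

Definition sub_sip : sip (sub_of S) :=
  Sip sub_formC sub_formPl (fun x => sip_ge0 g (sub_val x)).

End perp.

(** The limit [l] taken in the whole space stays orthogonal to [N]: for n in [N], g l n = - g (u M -
    l) n, which Cauchy-Schwarz makes arbitrarily small. *)
Lemma perp_complete (R : realType) (V : lmodType R) (g : sip V) (N : set V) :
  sip_complete g -> sip_complete (sub_sip g (perp g N)).
Proof.
move=> cg u uc.
have [|l lP] := cg (fun n => sub_val (u n)).
  move=> e e0; have [M MP] := uc _ e0; exists M => m n Mm Mn.
  by have := MP _ _ Mm Mn; rewrite /= /sub_form sub_valB.
have [|l' l'E] := @sub_of_ex _ _ (perp g N) l.
  move=> n Nn /=; apply/eqP; rewrite -sqrf_eq0 eq_le sqr_ge0 andbT.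
  apply/ler_addgt0Pl => e e0; rewrite addr0.
  have n1 : 0 < g n n + 1 by have := sip_ge0 g n; lra.
  have [M MP] := lP _ (divr_gt0 e0 n1).
  have := MP _ (leqnn M); rewrite ltr_pdivlMr// => h.
  rewrite (le_trans _ (ltW h))//.
  have := sip_CS g (sub_val (u M) - l) n; rewrite sipBl (sub_of_in (u M))// sub0r sqrrN.
  move=> h'; rewrite (le_trans h')// ler_wpM2l ?sip_ge0//; lra.
by exists l' => e /lP[M MP]; exists M => n /MP; rewrite /= /sub_form sub_valB -l'E.
Qed.

(** * The saddle-point problem over abstract Hilbert spaces *)

Section abstract_dual.
Context {R : realType} {U W H : lmodType R}.
Variables (gU : sip U) (gW : sip W) (gH : sip H).
Variables (i : H -> W) (dv : H -> U) (z k : R).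
Hypothesis iP : forall a x y, i (a *: x + y) = a *: i x + i y.
Hypothesis dvP : forall a x y, dv (a *: x + y) = a *: dv x + dv y.
Hypothesis gHE : forall x y, gH x y = gW (i x) (i y) + gU (dv x) (dv y).
Hypotheses (z0 : 0 < z) (k0 : 0 < k) (k1 : k < 1).

(** [U], [W] and [H] stand for L^2(Omega), L^2(Omega)^d and H_0(div), with [i] the underlying field
    and [dv] the divergence. The components are u, e, s and then the multipliers lambda, mu. *)
Definition dual_space : lmodType R := (U * W * H * (U * H))%type.
Definition dual_sip : sip dual_space :=
  sip_prod (sip_prod (sip_prod gU gW) gH) (sip_prod gU gH).

Lemma dual_sipE u e s l m (x := (u, e, s, (l, m))) :
  dual_sip x x = gU u u + gW e e + gH s s + (gU l l + gH m m).
Proof. by []. Qed.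

Definition dual_a (y1 y2 : U * W * H) :=
  gW y1.1.2 y2.1.2 + k * gW (i y1.2) (i y2.2).

Definition dual_b (y : U * W * H) (zz : U * H) :=
  gU zz.1 (dv y.2 + z *: y.1.1) + gW (i zz.2) y.1.2 + gU (dv zz.2) y.1.1.

(** The left-hand sides of the two equations added up: a single symmetric form, to which
    [symmetric_infsup] applies. *)
Definition dual_form (x w : dual_space) :=
  dual_a x.1 w.1 + dual_b w.1 x.2 + dual_b x.1 w.2.

Lemma dual_formC x w : dual_form x w = dual_form w x.
Proof. by rewrite /dual_form /dual_a sipC [gW (i _) _]sipC addrAC. Qed.

Lemma dual_form_linear x : linear_form (dual_form x).
Proof.
move=> a y w; rewrite /dual_form /dual_a /dual_b /= !(iP, dvP) !sipE; ring.
Qed.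

Lemma i_cont : sip_cont gH gW i.
Proof. by exists 1 => // x; rewrite mul1r gHE lerDl sip_ge0. Qed.

Lemma dv_cont : sip_cont gH gU dv.
Proof. by exists 1 => // x; rewrite mul1r gHE lerDr sip_ge0. Qed.

Let cs : sip_cont dual_sip gH (fun x => x.1.2).
Proof. exact: sip_cont_comp (sip_cont_fst _ _) (sip_cont_snd _ _). Qed.

Let ce : sip_cont dual_sip gW (fun x => x.1.1.2).
Proof.
exact: sip_cont_comp (sip_cont_comp (sip_cont_fst _ _) (sip_cont_fst _ _))
  (sip_cont_snd _ _).
Qed.

Let cu : sip_cont dual_sip gU (fun x => x.1.1.1).
Proof.
exact: sip_cont_comp (sip_cont_comp (sip_cont_fst _ _) (sip_cont_fst _ _))
  (sip_cont_fst _ _).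
Qed.

Let cl : sip_cont dual_sip gU (fun x => x.2.1).
Proof. exact: sip_cont_comp (sip_cont_snd _ _) (sip_cont_fst _ _). Qed.

Let cm : sip_cont dual_sip gH (fun x => x.2.2).
Proof. exact: sip_cont_comp (sip_cont_snd _ _) (sip_cont_snd _ _). Qed.

Lemma dual_form_bounded : bilinear_bounded dual_sip dual_form.
Proof.
have ci P : sip_cont dual_sip gH P -> sip_cont dual_sip gW (fun x => i (P x)).
  by move=> cP; exact: sip_cont_comp cP i_cont.
have cd P : sip_cont dual_sip gH P -> sip_cont dual_sip gU (fun x => dv (P x)).
  by move=> cP; exact: sip_cont_comp cP dv_cont.
have bb : bilinear_bounded dual_sip (fun x w => dual_b w.1 x.2).
  apply: bilinear_boundedD; first apply: bilinear_boundedD.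
  - apply: bilinear_bounded_sip => //.
    by apply: sip_contD; [exact: cd|exact: sip_contZ].
  - by apply: bilinear_bounded_sip => //; exact: ci.
  - by apply: bilinear_bounded_sip => //; exact: cd.
apply: bilinear_boundedD; first apply: bilinear_boundedD => //.
- apply: bilinear_boundedD; first exact: bilinear_bounded_sip.
  by apply: bilinear_boundedZ; apply: bilinear_bounded_sip; exact: ci.
- exact: (bilinear_boundedC bb).
Qed.

(* With e = re - i m, l = rl - z^-1 dv m and u = ru - z^-1 dv s, the terms
   involving re, rl, ru against s and m are cancelled by the tests below. *)
Definition dual_test (x : dual_space) : dual_space :=
  let: (u, e, s, (l, m)) := x in
  let re := e + i m in
  let rl := l + z^-1 *: dv m in
  let ru := u + z^-1 *: dv s in
  (rl - z^-1 *: (k^-1 *: dv s - dv m), re + (k^-1 *: i m + i s), k^-1 *: s - m,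
    (ru + z^-1 *: (k^-1 *: dv m + dv s), - (k^-1 *: m + s))).

Lemma dual_test_cont : sip_cont dual_sip dual_sip dual_test.
Proof.
have ci P : sip_cont dual_sip gH P -> sip_cont dual_sip gW (fun x => i (P x)).
  by move=> cP; exact: sip_cont_comp cP i_cont.
have cd P : sip_cont dual_sip gH P -> sip_cont dual_sip gU (fun x => dv (P x)).
  by move=> cP; exact: sip_cont_comp cP dv_cont.
(* Written with projections instead of pattern matching, the map is a composition that the closure
   lemmas for [sip_cont] can decompose. *)
rewrite (_ : dual_test = fun x : dual_space =>
  (x.2.1 + z^-1 *: dv x.2.2 - z^-1 *: (k^-1 *: dv x.1.2 - dv x.2.2),
   x.1.1.2 + i x.2.2 + (k^-1 *: i x.2.2 + i x.1.2), k^-1 *: x.1.2 - x.2.2,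
   (x.1.1.1 + z^-1 *: dv x.1.2 + z^-1 *: (k^-1 *: dv x.2.2 + dv x.1.2),
    - (k^-1 *: x.2.2 + x.1.2)))); last by apply/funext => -[[[u e] s] [l m]].
by repeat first [exact: cs | exact: cm | exact: cu | exact: ce | exact: cl
  | apply: sip_cont_pair | apply: sip_contN | apply: sip_contD | apply: sip_contZ
  | apply: ci | apply: cd].
Qed.

Let iD x y : i (x + y) = i x + i y.
Proof. by rewrite -[x in LHS]scale1r iP scale1r. Qed.
Let i0 : i 0 = 0.
Proof. by have /eqP := iD 0 0; rewrite addr0 -subr_eq subrr => /eqP. Qed.
Let iZ a x : i (a *: x) = a *: i x.
Proof. by rewrite -[_ *: _ in LHS]addr0 iP i0 addr0. Qed.
Let iN x : i (- x) = - i x.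
Proof. by rewrite -scaleN1r iZ scaleN1r. Qed.
Let dvD x y : dv (x + y) = dv x + dv y.
Proof. by rewrite -[x in LHS]scale1r dvP scale1r. Qed.
Let dv0 : dv 0 = 0.
Proof. by have /eqP := dvD 0 0; rewrite addr0 -subr_eq subrr => /eqP. Qed.
Let dvZ a x : dv (a *: x) = a *: dv x.
Proof. by rewrite -[_ *: _ in LHS]addr0 dvP dv0 addr0. Qed.
Let dvN x : dv (- x) = - dv x.
Proof. by rewrite -scaleN1r dvZ scaleN1r. Qed.

(** With primes for the second argument, the form splits as (re, re') + z (rl, ru') + z (ru, rl')
    plus the reduced form in s and m. The residuals of [dual_test] are re' = re, rl' = ru and ru' =
    rl, whence the three squares. In the reduced part the two terms k^-1 (dv s, dv m) have opposite
    signs and cancel. *)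
Lemma dual_form_test u e s l m :
  let re := e + i m in
  let rl := l + z^-1 *: dv m in
  let ru := u + z^-1 *: dv s in
  dual_form (u, e, s, (l, m)) (dual_test (u, e, s, (l, m))) =
  gW re re + z * gU rl rl + z * gU ru ru
  + gW (i s) (i s) + k^-1 * gW (i m) (i m) + (1 - k) * gW (i s) (i m)
  + z^-1 * (gU (dv s) (dv s) + gU (dv m) (dv m)).
Proof.
move=> re rl ru.
have -> : e = re - i m by rewrite addrK.
have -> : l = rl - z^-1 *: dv m by rewrite addrK.
have -> : u = ru - z^-1 *: dv s by rewrite addrK.
move: re rl ru => re rl ru.
rewrite /dual_form /dual_a /dual_b /= !(iD, iN, iZ, dvD, dvN, dvZ) !subrK !sipE.
rewrite ?[gW (i m) re]sipC ?[gW (i s) re]sipC ?[gW (i m) (i s)]sipC.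
rewrite ?[gU (dv s) rl]sipC ?[gU (dv m) rl]sipC ?[gU (dv s) ru]sipC.
rewrite ?[gU (dv m) ru]sipC ?[gU (dv m) (dv s)]sipC ?[gU rl ru]sipC.
by field; rewrite !gt_eqF.
Qed.

Lemma dual_infsup : exists2 c : R, 0 <= c &
  forall x, dual_sip x x <= c * dual_form x (dual_test x).
Proof.
have zi : 0 < z^-1 by rewrite invr_gt0.
(* Each summand pays for one group of terms: [z] times z^-1 gives the divergences once; 2 z^-1 gives
   the factor 2 on [rl] and [ru] and the 2 z^-2 on the divergences; 6 gives the factor 2 on [re]
   and, after halving, the factor 3 on [i s] and [i m]. *)
exists (z + 2 * z^-1 + 6); first by rewrite !addr_ge0// ltW// mulr_gt0.
move=> [[[u e] s] [l m]].
rewrite dual_form_test dual_sipE !gHE.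
set re := e + i m; set rl := l + z^-1 *: dv m; set ru := u + z^-1 *: dv s.
have he : gW e e <= 2 * gW re re + 2 * gW (i m) (i m).
  by have := sip_sqD gW re (- i m); rewrite addrK !sipE opprK.
have hl : gU l l <= 2 * gU rl rl + 2 * (z^-1 ^+ 2 * gU (dv m) (dv m)).
  by have := sip_sqD gU rl (- (z^-1 *: dv m)); rewrite addrK !sipE opprK mulrA.
have hu : gU u u <= 2 * gU ru ru + 2 * (z^-1 ^+ 2 * gU (dv s) (dv s)).
  by have := sip_sqD gU ru (- (z^-1 *: dv s)); rewrite addrK !sipE opprK mulrA.
(* Here k < 1 enters: (1 - k) |i s + i m|^2 >= 0 absorbs the cross term, and k^-1 >= 1 leaves at
   least half of both squares. *)
have hsm : (gW (i s) (i s) + gW (i m) (i m)) / 2 <=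
    gW (i s) (i s) + k^-1 * gW (i m) (i m) + (1 - k) * gW (i s) (i m).
  have ki : 1 <= k^-1 by rewrite invf_ge1// ltW.
  have := sip_ge0 gW (i m); have := sip_ge0 gW (i s).
  have := sip_ge0 gW (i s + i m); rewrite !sipE [gW (i m) (i s)]sipC.
  move: (gW (i s) (i s)) (gW (i m) (i m)) (gW (i s) (i m)) => a b c abc a0 b0.
  have : 0 <= (1 - k) * (a + c + (c + b)) by rewrite mulr_ge0// subr_ge0 ltW.
  have : 0 <= (k^-1 - 1) * b by rewrite mulr_ge0// subr_ge0.
  have : 0 <= k * a by rewrite mulr_ge0// ltW.
  have : 0 <= k * b by rewrite mulr_ge0// ltW.
  by move: k^-1 => ki'; lra.
set c := z + 2 * z^-1 + 6.
have c0 : 0 <= c by rewrite !addr_ge0// ltW// mulr_gt0.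
set Q := (X in _ <= c * X).
pose Q' := gW re re + z * gU rl rl + z * gU ru ru
  + (gW (i s) (i s) + gW (i m) (i m)) / 2
  + z^-1 * (gU (dv s) (dv s) + gU (dv m) (dv m)).
have QQ' : Q' <= Q by rewrite /Q /Q'; lra.
apply: (le_trans _ (ler_wpM2l c0 QQ')).
apply: (@le_trans _ _ (2 * gW re re + 2 * gU rl rl + 2 * gU ru ru
  + 3 * (gW (i s) (i s) + gW (i m) (i m))
  + (1 + 2 * z^-1 ^+ 2) * (gU (dv s) (dv s) + gU (dv m) (dv m)))).
  have := sip_ge0 gW (i s); have := sip_ge0 gW (i m).
  by move: he hl hu; move: z^-1 => y; lra.
have -> : c * Q' = c * gW re re + (z ^+ 2 + 2 + 6 * z) * (gU rl rl + gU ru ru)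
  + c / 2 * (gW (i s) (i s) + gW (i m) (i m))
  + (1 + 2 * z^-1 ^+ 2 + 6 * z^-1) * (gU (dv s) (dv s) + gU (dv m) (dv m)).
  by rewrite /c /Q'; field; rewrite gt_eqF.
have c6 : 6 <= c by rewrite lerDr addr_ge0// ltW// mulr_gt0.
rewrite -[X in X + 3 * _ + _]addrA -mulrDr.
rewrite !lerD// ler_wpM2r ?addr_ge0 ?sip_ge0//.
- lra.
- by have := sqr_ge0 z; have := ltW z0; lra.
- lra.
- by rewrite lerDl mulr_ge0// ltW.
Qed.

Lemma dual_exists F : sip_complete dual_sip -> linear_form F ->
  bounded_form dual_sip F -> exists x, forall w, dual_form x w = F w.
Proof.
move=> cX lF bF; have [c c0 cP] := dual_infsup.
exact: symmetric_infsup cX dual_formC dual_form_linear dual_form_bounded c0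
  dual_test_cont cP lF bF.
Qed.

(** [M] bounds the squared dual norm of the right-hand side. The squared inf-sup inequality, with
    the bound on the test, is divided once by [dual_sip x x]. *)
Lemma dual_apriori : exists2 C : R, 0 <= C & forall x M, 0 <= M ->
  (forall w, dual_form x w ^+ 2 <= M * dual_sip w w) -> dual_sip x x <= C * M.
Proof.
have [c c0 cP] := dual_infsup; have [K K0 KP] := dual_test_cont.
exists (c ^+ 2 * K) => [|x M M0 xM]; first by rewrite mulr_ge0 ?sqr_ge0.
have [g0|g0] := eqVneq (dual_sip x x) 0.
  by rewrite g0 !mulr_ge0 ?sqr_ge0.
have gp : 0 < dual_sip x x by rewrite lt_neqAle eq_sym g0 sip_ge0.
rewrite -(ler_pM2r gp) -expr2.
have h : dual_sip x x ^+ 2 <= c ^+ 2 * dual_form x (dual_test x) ^+ 2.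
  by rewrite -exprMn ler_sqr ?nnegrE ?cP ?(le_trans (sip_ge0 _ _) (cP x)) ?sip_ge0.
rewrite (le_trans h)// -!(mulrA (c ^+ 2)) ler_wpM2l ?sqr_ge0//.
rewrite (le_trans (xM _))// (_ : K * M * _ = M * (K * dual_sip x x)); last by ring.
by rewrite ler_wpM2l.
Qed.

End abstract_dual.

Arguments dual_space {R} U W H.

(** * Completeness of L^2 *)

(** The increments are dominated by a geometric series of ratio 1/2, so the telescoping series
    converges absolutely; [M + 1] stands in for the square root of [M]. *)
Lemma telescope_geometric_cvg (R : realType) (u : nat -> R) (M : R) :
  (forall k, 4 ^+ k * (u k.+1 - u k) ^+ 2 <= M) -> cvgn u.
Proof.
move=> uM.
have M0 : 0 <= M by apply: le_trans (uM 0%N); rewrite mulr_ge0 ?sqr_ge0 ?exprn_ge0.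
have ul k : `|telescope u k| <= geometric (M + 1) 2^-1 k.
  rewrite /telescope /geometric /= -ler_sqr ?nnegrE ?mulr_ge0 ?exprn_ge0//; last lra.
  have p4 : 0 < 4 ^+ k :> R by rewrite exprn_gt0.
  rewrite real_normK ?num_real// -(ler_pM2l p4) (le_trans (uM k))//.
  have -> : 4 ^+ k * ((M + 1) * 2^-1 ^+ k) ^+ 2 = (M + 1) ^+ 2.
    rewrite exprMn mulrCA -exprM mulnC exprM -exprMn.
    by rewrite (_ : 4 * 2^-1 ^+ 2 = 1) ?expr1n ?mulr1//; field.
  by nra.
have /normed_cvg cu : cvgn [normed series (telescope u)].
  apply: (series_le_cvg _ _ ul) => [k|k|].
  - exact: normr_ge0.
  - exact: le_trans (ul k).
  - by apply: is_cvg_geometric_series; rewrite ger0_norm; lra.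
rewrite (_ : u = fun n => u 0%N + series (telescope u) n).
  by apply: is_cvgD => //; exact: is_cvg_cst.
by apply/funext => n; exact: eq_sum_telescope.
Qed.

Section L2_complete.
Context d (T : measurableType d) (R : realType).
Variables (mu : {measure set T -> \bar R}) (D : set T) (mD : measurable D).

Let sqdist (f g : T -> R) := (\int[mu]_(x in D) ((f x - g x) ^+ 2)%:E)%E.

Let msq (f g : T -> R) : measurable_fun D f -> measurable_fun D g ->
  measurable_fun D (fun x => ((f x - g x) ^+ 2 : R)%:E).
Proof.
move=> mf mg; apply/measurable_EFinP; apply: measurable_funX.
exact: measurable_funB.
Qed.

(* Fatou along a sequence of which [l] is the limit almost everywhere *)
Lemma sqdist_fatou (f l : T -> R) (h : nat -> T -> R) (N : set T) (e : R) :
  measurable N -> mu N = 0%E -> measurable_fun D f -> measurable_fun D l ->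
  (forall k, measurable_fun D (h k)) ->
  (forall x, (D `\` N) x -> h ^~ x @ \oo --> l x) ->
  (forall k, (sqdist f (h k) <= e%:E)%E) -> (sqdist f l <= e%:E)%E.
Proof.
move=> mN N0 mf ml mh hl he.
have mA : measurable (D `\` N) by exact: measurableD.
have sq0 g k x : (0 <= ((g x - k x) ^+ 2)%:E :> \bar R)%E by rewrite lee_fin sqr_ge0.
rewrite /sqdist (ge0_negligible_integral mN)//; last exact: msq.
have -> : (\int[mu]_(x in D `\` N) ((f x - l x) ^+ 2)%:E =
    \int[mu]_(x in D `\` N) limn_einf (fun k => ((f x - h k x) ^+ 2)%:E))%E.
  apply: eq_integral => x /set_mem Ax; apply/esym.
  have cx : (fun k => ((f x - h k x) ^+ 2)%:E) @ \oo --> ((f x - l x) ^+ 2)%:E.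
    apply: cvg_EFin; first by exact: nearW.
    rewrite /= (_ : _ \o _ = (fun k => (f x - h k x) ^+ 2))//.
    under eq_fun do rewrite expr2.
    by rewrite expr2; apply: cvgM; (apply: cvgB; [exact: cvg_cst|exact: hl]).
  by rewrite is_cvg_limn_einfE; [exact/cvg_lim|exact: cvgP cx].
apply: (le_trans (fatou _ mA _ _)) => [n|n x _|].
- by apply: measurable_funS (msq mf (mh n)) => // x [].
- exact: sq0.
- rewrite limn_einf_lim; apply: lime_le; first exact: is_cvg_einfs.
  apply: nearW => n.
  apply: (@le_trans _ _ (\int[mu]_(x in D `\` N) ((f x - h n x) ^+ 2)%:E)%E).
    by apply: ereal_inf_lbound; exists n => /=.
  rewrite (le_trans _ (he n))// ge0_subset_integral//.
  exact: msq.
Qed.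

(** Riesz-Fischer: along a fast subsequence the weighted squared increments have an integrable sum,
    which is therefore finite almost everywhere and forces pointwise convergence. Fatou's lemma then
    carries the Cauchy bound to the limit. *)
Lemma L2_complete (f : nat -> T -> R) : (forall n, measurable_fun D (f n)) ->
  (forall e : R, 0 < e -> exists N, forall m n, (N <= m)%N -> (N <= n)%N ->
    (sqdist (f m) (f n) <= e%:E)%E) ->
  exists2 l, measurable_fun D l & forall e : R, 0 < e ->
    exists N, forall n, (N <= n)%N -> (sqdist (f n) l <= e%:E)%E.
Proof.
move=> mf cf.
(* The factor 4^-k cancels the weight in [dk]; the factors 2^-(k+1) that remain are summable. *)
have e_gt0 k : 0 < (4 ^+ k)^-1 * (1 / (2 ^ k.+1)%:R) :> R.
  by rewrite mulr_gt0 ?invr_gt0 ?exprn_gt0// divr_gt0// ltr0n expn_gt0.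
have /choice[N NP] k := cf _ (e_gt0 k).
(* Summing all thresholds up to k makes [phi] monotone and at least [N k]; the added k makes it also
   at least k, so that the subsequence passes any given index. *)
pose phi k := (k + \sum_(j < k.+1) N j)%N.
have Nphi k : (N k <= phi k)%N by rewrite /phi big_ord_recr addnA leq_addl.
have phiS k : (phi k <= phi k.+1)%N 
  by rewrite /phi [in leqRHS]big_ord_recr/= leq_add// leq_addr.
pose h k := f (phi k).
pose dk k x : \bar R := (4 ^+ k * (h k.+1 x - h k x) ^+ 2)%:E.
have mdk k : measurable_fun D (dk k).
  apply/measurable_EFinP; apply: measurable_funM; first exact: measurable_cst.
  by apply: measurable_funX; apply: measurable_funB; exact: mf.
have dk0 k x : D x -> (0 <= dk k x)%E.
  by rewrite lee_fin mulr_ge0 ?sqr_ge0 ?exprn_ge0.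
have idk k : (\int[mu]_(x in D) dk k x <= (1 / (2 ^ k.+1)%:R)%:E)%E.
  rewrite /dk; under eq_integral do rewrite EFinM.
  have sq0 x : D x -> (0 <= ((h k.+1 x - h k x) ^+ 2)%:E)%E.
    by rewrite lee_fin sqr_ge0.
  rewrite (ge0_integralZl_EFin mu mD sq0 (msq (mf _) (mf _))) ?exprn_ge0//.
  have := NP k (phi k.+1) (phi k) (leq_trans (Nphi k) (phiS k)) (Nphi k).
  have p4 : (0 <= (4 ^+ k)%:E :> \bar R)%E by rewrite lee_fin exprn_ge0.
  move=> /(lee_wpmul2l p4)/le_trans; apply.
  by rewrite -EFinM mulVKf// expf_neq0.
pose S x := (\sum_(k <oo) dk k x)%E.
have mS : measurable_fun D S.
  by apply: (@ge0_emeasurable_sum _ _ _ _ dk xpredT) => // k x Dx _; exact: dk0.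
have S0 x : D x -> (0 <= S x)%E.
  by move=> Dx; apply: nneseries_ge0 => k _ _; exact: dk0.
have iS : mu.-integrable D S.
  apply/integrableP; split => //.
  under eq_integral => x /set_mem Dx do rewrite gee0_abs ?S0//.
  rewrite integral_nneseries// (@le_lt_trans _ _ 1%:E) ?ltry//.
  apply: (le_trans _ (epsilon_trick0 xpredT (@ler01 R))).
  apply: lee_nneseries => [k _ _|k _]; last exact: idk.
  by apply: integral_ge0 => x; exact: dk0.
have [N0 [mN0 N00 N0P]] := integrable_ae mD iS.
have hcvg x : (D `\` N0) x -> cvgn (h ^~ x).
  move=> [Dx N0x]; have Sfin : S x \is a fin_num.
    by apply: contrapT => nS; apply/N0x/N0P => /(_ Dx).
  apply: (@telescope_geometric_cvg _ _ (fine (S x))) => k.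
  rewrite -lee_fin fineK//.
  apply: (le_trans _ (nneseries_lim_ge k.+1 (fun n _ _ => dk0 n x Dx))).
  rewrite big_nat_recr//= leeDr// sume_ge0// => i _; exact: dk0.
pose l := (fun x => limn (h ^~ x)) \_ (D `\` N0).
have hl x : (D `\` N0) x -> h ^~ x @ \oo --> l x.
  by move=> Ax; rewrite /l patchE mem_set//; exact: hcvg.
have mA : measurable (D `\` N0) by exact: measurableD.
have ml : measurable_fun D l.
  apply: measurable_funTS; apply/(measurable_restrictT _ mA).
  apply: (@measurable_fun_cvg _ _ _ _ h) => [k|x Ax]; last exact: hcvg.
  by apply: measurable_funS (mf (phi k)) => // x [].
exists l => // e e0; have [M MP] := cf _ e0; exists M => n Mn.
(* Fatou is applied to the tail shifted by [M], all of whose indices in the original sequence are at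
   least [M]. *)
apply: (@sqdist_fatou _ _ (fun k => h (k + M)%N) _ _ mN0 N00) => // [k|x Ax|k].
- exact: mf.
- by have := hl x Ax; rewrite -(cvg_shiftn M).
- by apply: MP => //; rewrite /phi (leq_trans (leq_addl k M))// leq_addr.
Qed.

End L2_complete.

(** * Open sets, continuous functions and cubes in R^n *)

Section row_borel.
Context {R : realType}.

(** The sigma-algebra is the one generated by the coordinates, so an open set is covered by
    countably many coordinate boxes, with rational centres and radii 1/(k+1). Those that leave [O]
    are replaced by the empty set, which keeps a countable type as index set. *)
Lemma measurable_open_row n (O : set 'rV[R]_n) : open O -> measurable O.
Proof.
move=> oO.
pose box (p : 'rV[rat]_n * nat) : set 'rV[R]_n :=
  \bigcap_(i in [set: 'I_n]) [set x | `|x ord0 i - ratr (p.1 ord0 i)| < p.2.+1%:R^-1].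
pose box' p := if `[< box p `<=` O >] then box p else set0.
have -> : O = \bigcup_p box' p.
  apply/seteqP; split => [x Ox|x [p _]]; last first.
    by rewrite /box'; case: ifPn => [/asboolP pO /pO|].
  have /nbhs_ballP[e /= e0 eO] := oO x Ox.
  have [k _ /(_ k (leqnn k)) /= ke] :=
    near_infty_natSinv_lt (PosNum (divr_gt0 e0 (ltr0Sn R 1))).
  have k0 : 0 < k.+1%:R^-1 :> R by rewrite invr_gt0.
  have /choice[q qP] (i : 'I_n) : exists q : rat, `|x ord0 i - ratr q| < k.+1%:R^-1.
    move: k.+1%:R^-1 k0 => r r0.
    have /rat_in_itvoo[q] : x ord0 i - r < x ord0 i + r by lra.
    by rewrite in_itv /= => /andP[h1 h2]; exists q; rewrite ltr_norml; lra.
  pose p : 'rV[rat]_n * nat := (\row_i q i, k).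
  have px : box p x by move=> i _ /=; rewrite mxE.
  exists p => //; rewrite /box' asboolT// => y py; apply: eO.
  split => // i j; rewrite !ord1 /ball /=.
  have := px j I; have := py j I; rewrite /= !mxE => h1 h2.
  have -> : x 0 j - y 0 j = (x 0 j - ratr (q j)) - (y 0 j - ratr (q j)) by ring.
  rewrite (le_lt_trans (ler_normB _ _))//.
  by move: ke h1 h2; move: k.+1%:R^-1 => r; lra.
apply: countable_bigcupT_measurable => // p; rewrite /box'; case: ifPn => // _.
apply: fin_bigcap_measurable => // i _.
have mi : measurable_fun [set: 'rV[R]_n]
    (fun x : 'rV[R]_n => `|x ord0 i - ratr (p.1 ord0 i)|).
  apply: measurableT_comp => //; apply: measurable_funB => //.
  exact: measurable_coord.
rewrite [X in measurable X](_ : _ = [set: 'rV[R]_n] `&`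
  (fun x : 'rV[R]_n => `|x ord0 i - ratr (p.1 ord0 i)|) @^-1` `]-oo, p.2.+1%:R^-1[).
  exact: mi.
by rewrite setTI; apply/seteqP; split => x; rewrite /= in_itv.
Qed.

Lemma continuous_measurable_row n (f : 'rV[R]_n -> R) :
  continuous f -> measurable_fun [set: 'rV[R]_n] f.
Proof.
move=> /continuousP cf.
apply: (measurability _ (RGenOpens.measurableE R)) => _ [_ [a [b ->] <-]].
rewrite setTI; apply: measurable_open_row; apply: cf; exact: interval_open.
Qed.

Definition cube n (M : R) : set 'rV[R]_n := [set v | forall i, v ord0 i \in `[- M, M]].

Lemma measurable_cube n M : measurable (@cube n M).
Proof.
rewrite (_ : cube M = \bigcap_(i in [set: 'I_n])
  ([set: 'rV[R]_n] `&` (fun x : 'rV[R]_n => x ord0 i) @^-1` `[- M, M])).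
  apply: fin_bigcap_measurable => // i _; exact: measurable_coord.
by apply/seteqP; split => [x xM i _|x xM i]; [split => //; exact: xM|have [] := xM i I].
Qed.

Lemma lebesgue_row_cube n M : (lebesgue_row n (@cube n M) < +oo)%E.
Proof.
elim: n => [|n IH] /=.
  by rewrite diracE; case: (_ \in _); rewrite ?ltry.
rewrite /cons_measure /pushforward (_ : _ @^-1` _ = `[- M, M]%classic `*` cube M).
  rewrite product_measure1E//; last exact: measurable_cube.
  rewrite lte_mul_pinfty//.
  rewrite ge0_fin_numE//.
  rewrite (_ : _ `[- M, M]%classic =
    (if (- M)%:E < M%:E then M%:E - (- M)%:E else 0)%E).
    by case: ifP => //; rewrite -?EFinD ltry.
  exact: (lebesgue_measure_itv `[- M, M]).
have rowl (p : R * 'rV[R]_n) j : row_cons p ord0 (@lshift 1 n j) = p.1.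
  by rewrite (@row_mxEl _ _ 1 n) mxE.
have rowr (p : R * 'rV[R]_n) j : row_cons p ord0 (@rshift 1 n j) = p.2 ord0 j.
  exact: (@row_mxEr _ _ 1 n).
apply/seteqP; split => [[a v] h|[a v] /= [ha hv] i].
  split => /= [|i]; first by have := h (@lshift 1 n ord0); rewrite rowl.
  by have := h (@rshift 1 n i); rewrite rowr.
by have [j ->|j ->] := @split_ordP 1 n i; rewrite ?rowl ?rowr//; exact: hv.
Qed.

Lemma compact_cube n M : compact (@cube n M).
Proof.
rewrite (_ : cube M = [set v : 'rV[R]_n | forall i, `[- M, M]%classic (v ord0 i)])//.
by apply: (@rV_compact _ _ (fun=> `[- M, M]%classic)) => _; exact: segment_compact.
Qed.

Lemma bounded_sub_cube n (A : set 'rV[R]_n) :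
  bounded_set A -> exists M, A `<=` cube M.
Proof.
move=> [M [Mreal AM]]; exists (M + 1) => v /AM vM i.
suff : `|v ord0 i| <= M + 1 by rewrite ler_norml in_itv.
apply: (le_trans _ (vM _ _)); last by rewrite ltrDl.
rewrite [leRHS]/Num.norm /= mx_normrE; apply/bigmax_geP; right.
by exists (ord0, i).
Qed.

End row_borel.

(** * Square-integrable functions on Omega *)

Section L2_space.
Context {R : realType} {d : nat}.
Variable Omega : set 'rV[R]_d.
Hypothesis mO : measurable Omega.
Local Notation leb := (lebesgue_row d).

(** Passes from the extension by zero, in terms of which [L2] is defined, to integrals over [Omega],
    in terms of which completeness is proved. *)
Lemma L2P (f : 'rV[R]_d -> R) : L2 Omega f <->
  measurable_fun Omega f /\ (\int[leb]_(x in Omega) (f x ^+ 2)%:E < +oo)%E.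
Proof.
have sqE : (\int[leb]_(x in Omega) (f x ^+ 2)%:E =
    \int[leb]_x ((f \_ Omega) x ^+ 2)%:E)%E.
  rewrite integral_mkcond; apply: eq_integral => x _.
  by rewrite !patchE; case: ifPn; rewrite ?expr0n.
have sq0 : (0 <= \int[leb]_x ((f \_ Omega) x ^+ 2)%:E)%E.
  by apply: integral_ge0 => x _; rewrite lee_fin sqr_ge0.
rewrite sqE; split => [Lf|[mf fi]].
  split; last exact: integrable_lty (Lfun2_integrable_sqr Lf).
  by apply/(measurable_restrictT _ mO); move: Lf => /andP[/set_mem].
rewrite /L2/= inE; apply/andP; split.
  by apply/mem_set/(measurable_restrictT _ mO).
apply/mem_set; rewrite /= /finite_norm unlock /=.
rewrite poweR_lty//; under eq_integral => x _.
  by rewrite powR_mulrn ?normr_ge0// -normrX ger0_norm ?sqr_ge0//; over.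
by [].
Qed.

Lemma L2_submod : submod_closed [pred f | f \in L2 Omega].
Proof.
have rP a (f g : 'rV[R]_d -> R) :
    (a *: f + g) \_ Omega = a *: (f \_ Omega) + g \_ Omega.
  apply/funext => x; rewrite /= !fctE /= !patchE.
  by case: ifPn => // _; rewrite scaler0 addr0.
have [L0 LP] := Lfun_submod_closed leb (@lee1n R 2).
split=> [|a f g /set_mem Lf /set_mem Lg]; apply/mem_set.
  rewrite /L2 /= (_ : _ \_ _ = 0); first exact: L0.
  by apply/funext => x; rewrite patchE; case: ifPn.
by rewrite /L2 /= rP; exact: LP.
Qed.

Lemma L2_mul_integrable (f g : 'rV[R]_d -> R) : L2 Omega f -> L2 Omega g ->
  leb.-integrable Omega (EFin \o (fun x => f x * g x)).
Proof.
move=> Lf Lg; apply/(integrable_mkcond _ mO).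
have /Lfun1_integrable := Lfun2_mul_Lfun1 Lf Lg.
apply: eq_integrable => // x _.
by rewrite /= !patchE; case: ifPn => //=; rewrite ?mulr0.
Qed.

Lemma ipC (f g : 'rV[R]_d -> R) : ip Omega f g = ip Omega g f.
Proof. by apply: eq_Rintegral => x _; rewrite mulrC. Qed.

Lemma ipPl a (f g h : 'rV[R]_d -> R) : L2 Omega f -> L2 Omega g -> L2 Omega h ->
  ip Omega (a *: f + g) h = a * ip Omega f h + ip Omega g h.
Proof.
move=> Lf Lg Lh; rewrite /ip.
have ifh := L2_mul_integrable Lf Lh; have igh := L2_mul_integrable Lg Lh.
have iafh : leb.-integrable Omega (EFin \o (fun x => a * (f x * h x))).
  exact: (integrableZl mO a ifh).
rewrite -RintegralZl// -RintegralD//.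
by apply: eq_Rintegral => x _; rewrite /= mulrDl mulrA.
Qed.

Lemma ip_ge0 (f : 'rV[R]_d -> R) : 0 <= ip Omega f f.
Proof. by apply: Rintegral_ge0 => x _; rewrite -expr2 sqr_ge0. Qed.

Lemma ip_sqE (f : 'rV[R]_d -> R) : L2 Omega f ->
  ((ip Omega f f)%:E = \int[leb]_(x in Omega) (f x ^+ 2)%:E)%E.
Proof.
move=> Lf; rewrite /ip /Rintegral fineK; last first.
  exact: integrable_fin_num (L2_mul_integrable Lf Lf).
by apply: eq_integral => x _; rewrite expr2.
Qed.

Lemma ip_eq0 (f : 'rV[R]_d -> R) : L2 Omega f -> ip Omega f f = 0 ->
  ae_eq leb Omega f (cst 0).
Proof.
move=> Lf f0; have [mf _] := (L2P f).1 Lf.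
have : ae_eq leb Omega (fun x => (f x ^+ 2)%:E) (cst 0%E).
  apply/(ae_eq_integral_abs _ mO); first exact/measurable_EFinP/measurable_funX.
  under eq_integral => x _ do rewrite gee0_abs ?lee_fin ?sqr_ge0//.
  by rewrite -ip_sqE// f0.
apply: filterS => x h Ox; have [/eqP] := h Ox.
by rewrite sqrf_eq0 => /eqP.
Qed.

Lemma L2_continuous M (f : 'rV[R]_d -> R) :
  Omega `<=` cube M -> continuous f -> L2 Omega f.
Proof.
move=> OM cf; have mf := continuous_measurable_row cf.
apply/L2P; split; first exact: measurable_funTS.
have Ofin : (leb Omega < +oo)%E.
  apply: le_lt_trans (lebesgue_row_cube d M).
  by apply: le_measure; rewrite ?inE//; exact: measurable_cube.
have [B [_ Bf]] : bounded_set (f @` cube M).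
  apply: compact_bounded; apply: continuous_compact; last exact: compact_cube.
  exact: continuous_subspaceT.
have : leb.-integrable Omega (EFin \o (fun x => f x ^+ 2)).
  apply: measurable_bounded_integrable => //.
    exact/measurable_funTS/measurable_funX.
  (* [bounded_set] gives bounds only by numbers strictly above [B], hence [B + 1]. *)
  exists (`|B + 1| ^+ 2); split; first exact: num_real.
  move=> C BC x Ox /=; rewrite (le_trans _ (ltW BC))// normrX ler_sqr ?nnegrE//.
  rewrite (le_trans (Bf (B + 1) _ _ _)) ?ler_norm ?ltrDl//.
  by exists x => //; exact: OM.
exact: integrable_lty.
Qed.

End L2_space.

(** * L^2(Omega) and L^2(Omega)^d as complete semi-inner product spaces *)

Section L2_sip.
Context {R : realType} {d : nat}.
Variable Omega : set 'rV[R]_d.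
Hypothesis mO : measurable Omega.
Local Notation leb := (lebesgue_row d).

Definition L2_subspace := Subspace (L2_submod Omega).
Definition L2_type := sub_of L2_subspace.
Local Notation U := L2_type.

Lemma L2_val (f : U) : L2 Omega (sub_val f).
Proof. exact: sub_of_in f. Qed.

Lemma L2_lift (f : 'rV[R]_d -> R) : L2 Omega f -> {g : U | sub_val g = f}.
Proof. exact: (@sub_of_ex _ _ L2_subspace). Qed.

Definition L2_form (f g : U) := ip Omega (sub_val f) (sub_val g).

Lemma L2_formC f g : L2_form f g = L2_form g f. Proof. exact: ipC. Qed.

Lemma L2_formPl a f g h : L2_form (a *: f + g) h = a * L2_form f h + L2_form g h.
Proof. by rewrite /L2_form sub_valP ipPl//; exact: L2_val. Qed.

Definition L2_sip := Sip L2_formC L2_formPl (fun f => ip_ge0 Omega (sub_val f)).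
Local Notation gU := L2_sip.

Lemma L2_sip_complete : sip_complete gU.
Proof.
move=> u uc; pose f n := sub_val (u n).
have Lf n : L2 Omega (f n) := L2_val (u n).
have LB (g h : 'rV[R]_d -> R) : L2 Omega g -> L2 Omega h -> L2 Omega (g - h).
  move=> /L2_lift[g' <-] /L2_lift[h' <-]; rewrite -sub_valB; exact: L2_val.
have [n|e e0|l ml lP] := @L2_complete _ _ _ leb _ mO f.
- by have [] := (L2P mO _).1 (Lf n).
- have [N NP] := uc _ e0; exists N => m n Nm Nn.
  rewrite -[X in (X <= _)%E](ip_sqE mO (LB _ _ (Lf m) (Lf n))) lee_fin.
  by have := NP _ _ Nm Nn; rewrite /= /L2_form sub_valB => /ltW.
have Ll : L2 Omega l.
  have [N /(_ N (leqnn N)) NP] := lP 1 ltr01.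
  have -> : l = f N - (f N - l) by rewrite opprB addrC subrK.
  apply: LB => //; apply/(L2P mO); split; last exact: le_lt_trans NP (ltry _).
  by apply: measurable_funB => //; have [] := (L2P mO _).1 (Lf N).
have [l' l'E] := L2_lift Ll; subst l; exists l' => e e0.
have e2 : 0 < e / 2 by rewrite divr_gt0.
have [N NP] := lP _ e2; exists N => n Nn.
rewrite (@le_lt_trans _ _ (e / 2))//; last lra.
rewrite -lee_fin /= /L2_form sub_valB (ip_sqE mO (LB _ _ (Lf n) Ll)).
exact: NP.
Qed.

Lemma L2v_submod : submod_closed [pred s | s \in L2v Omega].
Proof.
have [L0 LP] := L2_submod Omega.
split=> [|a s t /set_mem Ls /set_mem Lt]; apply/mem_set => i.
  have := set_mem L0; congr (L2 _ _).
  by apply/funext => x; rewrite [RHS]mxE.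
rewrite (_ : (fun _ => _) = a *: (fun x => s x ord0 i) + (fun x => t x ord0 i)).
  by apply: set_mem; apply: LP; apply: mem_set; [exact: Ls|exact: Lt].
by apply/funext => x; rewrite !fctE /= !mxE.
Qed.

Lemma ipvE (s t : 'rV[R]_d -> 'rV[R]_d) : L2v Omega s -> L2v Omega t ->
  ipv Omega s t = \sum_i ip Omega (fun x => s x ord0 i) (fun x => t x ord0 i).
Proof.
move=> Ls Lt; rewrite /ipv /dot /ip.
(* Integrability of the partial sums is carried through the induction, since additivity of the
   integral requires it. *)
suff [] : leb.-integrable Omega
    (EFin \o (fun x => \sum_i s x ord0 i * t x ord0 i)) /\
    (\int[leb]_(x in Omega) (\sum_i s x ord0 i * t x ord0 i))%R =
    \sum_i (\int[leb]_(x in Omega) (s x ord0 i * t x ord0 i))%R by [].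
elim: (index_enum _) => [|i r [IHi IHe]].
  rewrite big_nil; split.
    under eq_fun do rewrite big_nil; exact: integrable0.
  by under eq_Rintegral do rewrite big_nil; rewrite Rintegral_cst// mul0r.
have ii := L2_mul_integrable mO (Ls i) (Lt i).
rewrite big_cons; split.
  by apply: eq_integrable (integrableD mO ii IHi) => // x _; rewrite /= big_cons.
under eq_Rintegral do rewrite big_cons.
by rewrite RintegralD// IHe.
Qed.

Definition L2v_subspace := Subspace L2v_submod.
Definition L2v_type := sub_of L2v_subspace.
Local Notation W := L2v_type.

Lemma L2v_val (f : W) : L2v Omega (sub_val f).
Proof. exact: sub_of_in f. Qed.

Lemma L2v_lift (f : 'rV[R]_d -> 'rV[R]_d) : L2v Omega f -> {g : W | sub_val g = f}.
Proof. exact: (@sub_of_ex _ _ L2v_subspace). Qed.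

Definition L2v_form (f g : W) := ipv Omega (sub_val f) (sub_val g).

Lemma L2v_formE f g : L2v_form f g =
  \sum_i ip Omega (fun x => sub_val f x ord0 i) (fun x => sub_val g x ord0 i).
Proof. by rewrite /L2v_form ipvE//; exact: L2v_val. Qed.

Lemma L2v_formC f g : L2v_form f g = L2v_form g f.
Proof. by rewrite !L2v_formE; apply: eq_bigr => i _; exact: ipC. Qed.

Lemma L2v_formPl a f g h :
  L2v_form (a *: f + g) h = a * L2v_form f h + L2v_form g h.
Proof.
rewrite !L2v_formE big_distrr -big_split /=; apply: eq_bigr => i _.
rewrite -ipPl//; [|exact: (L2v_val f)|exact: (L2v_val g)|exact: (L2v_val h)].
by congr ip; apply/funext => x; rewrite !fctE /= !mxE.
Qed.

Lemma L2v_form_ge0 f : 0 <= L2v_form f f.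
Proof. by rewrite L2v_formE sumr_ge0// => i _; exact: ip_ge0. Qed.

Definition L2v_sip := Sip L2v_formC L2v_formPl L2v_form_ge0.
Local Notation gW := L2v_sip.

Lemma L2v_sip_complete : sip_complete gW.
Proof.
move=> u uc.
have /choice[c cP] (i : 'I_d) : exists c : nat -> U, forall n,
    sub_val (c n) = (fun x => sub_val (u n) x ord0 i).
  have /choice[c cP] n : exists c : U, sub_val c = (fun x => sub_val (u n) x ord0 i).
    by have [c cE] := L2_lift (L2v_val (u n) i); exists c.
  by exists c.
have dist i m n : gU (c i m - c i n) (c i m - c i n) <= gW (u m - u n) (u m - u n).
  rewrite /= L2v_formE (bigD1 i)//= ler_wpDr//.
    by apply: sumr_ge0 => j _; exact: ip_ge0.
  rewrite /L2_form !sub_valB /= !cP.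
  rewrite le_eqVlt; apply/orP; left; apply/eqP.
  by congr ip; apply/funext => x; rewrite !fctE /= !mxE.
have /choice[l lP] i : exists l, sip_cvg gU (c i) l.
  apply: L2_sip_complete => e e0; have [N NP] := uc _ e0; exists N => m n Nm Nn.
  exact: le_lt_trans (dist i m n) (NP _ _ Nm Nn).
have [|w wE] := @L2v_lift (fun x => \row_i sub_val (l i) x).
  move=> i; rewrite (_ : (fun _ => _) = sub_val (l i)); first exact: L2_val.
  by apply/funext => x; rewrite mxE.
exists w => e e0; have e1 : 0 < e / d.+1%:R by rewrite divr_gt0.
have /choice[N NP] i := lP i _ e1.
exists (\max_i N i)%N => n Nn.
rewrite /= L2v_formE (@le_lt_trans _ _ (\sum_(i < d) e / d.+1%:R))//.
  apply: ler_sum => i _; apply: ltW.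
  have := NP i n (leq_trans (leq_bigmax i) Nn); congr (_ < _).
  rewrite /= /L2_form !sub_valB /= !cP wE.
  by congr ip; apply/funext => x; rewrite !fctE /= !mxE.
rewrite sumr_const card_ord -[_ *+ d]mulr_natr -mulrA gtr_pMr// mulrC ltr_pdivrMr//.
by rewrite mul1r ltr_nat.
Qed.

End L2_sip.

(** * H_0(div) and the dual problem *)

Section H0div_space.
Context {R : realType} {d : nat}.
Variables (Omega : set 'rV[R]_d) (M : R).
Hypotheses (mO : measurable Omega) (OM : Omega `<=` cube M).
Local Notation leb := (lebesgue_row d).
Local Notation U := (L2_type Omega).
Local Notation W := (L2v_type Omega).
Local Notation gU := (L2_sip mO).
Local Notation gW := (L2v_sip mO).

(* Both the weak divergence and the vanishing normal trace are orthogonality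
   conditions on the pair (s, div s). *)
Definition H0div_tests : set (W * U) := [set n |
  (test_function Omega (sub_val n.2) /\
    sub_val n.1 = gradient (sub_val n.2)) \/
  sobolev_H1 Omega (sub_val n.2, sub_val n.1)].

Definition H0div_subspace := perp (sip_prod gW gU) H0div_tests.
Definition H0div_type := sub_of H0div_subspace.
Local Notation H := H0div_type.
Definition H0div_sip := sub_sip (sip_prod gW gU) H0div_subspace.
Local Notation gH := H0div_sip.

Definition H0div_field (h : H) : W := (sub_val h).1.
Definition H0div_div (h : H) : U := (sub_val h).2.

Lemma H0div_fieldP a x y :
  H0div_field (a *: x + y) = a *: H0div_field x + H0div_field y.
Proof. by rewrite /H0div_field sub_valP. Qed.

Lemma H0div_divP a x y :
  H0div_div (a *: x + y) = a *: H0div_div x + H0div_div y.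
Proof. by rewrite /H0div_div sub_valP. Qed.

Lemma H0div_fieldB x y : H0div_field (x - y) = H0div_field x - H0div_field y.
Proof. by rewrite /H0div_field sub_valB. Qed.

Lemma H0div_divB x y : H0div_div (x - y) = H0div_div x - H0div_div y.
Proof. by rewrite /H0div_div sub_valB. Qed.

Lemma H0div_sipE x y : gH x y =
  gW (H0div_field x) (H0div_field y) + gU (H0div_div x) (H0div_div y).
Proof. by []. Qed.

Lemma H0div_sip_complete : sip_complete gH.
Proof.
apply: perp_complete; apply: sip_prod_complete.
- exact: L2v_sip_complete.
- exact: L2_sip_complete.
Qed.

(** Makes every test function, paired with its gradient, an element of the space where orthogonality
    is expressed, so that [H0div_tests] captures the whole definition of the weak divergence. *)
Lemma test_function_L2 phi : test_function Omega phi ->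
  L2 Omega phi /\ L2v Omega (gradient phi).
Proof.
move=> [smooth _]; split; first exact: L2_continuous OM (smooth 0%N).
move=> i; rewrite (_ : (fun _ => _) = pderiv i phi).
  by have [_ /(_ i)] := smooth 1%N; exact: L2_continuous OM.
by apply/funext => x; rewrite mxE.
Qed.

Lemma H0div_subspaceP (s : W) (g : U) :
  subspace_set H0div_subspace (s, g) <-> H0div Omega (sub_val s, sub_val g).
Proof.
split=> [h|[[_ _ wd] nt] [G v] /= [[tv GE]|/= Hv]].
- split; [split => /=; [exact: L2v_val|exact: L2_val|]|].
    move=> phi tphi; have [L2p L2g] := test_function_L2 tphi.
    have [v vE] := L2_lift L2p; have [G GE] := L2v_lift L2g.
    have /h : H0div_tests (G, v) by left; rewrite /= GE vE.
    rewrite /= /prod_form /= /L2v_form /L2_form GE vE => /eqP.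
    by rewrite addr_eq0 => /eqP.
  move=> [v G] /[dup] Hv [/= L2p L2g _].
  have [v' vE] := L2_lift L2p; have [G' GE] := L2v_lift L2g.
  have /h : H0div_tests (G', v') by right; rewrite /= GE vE.
  by rewrite /= /prod_form /= /L2v_form /L2_form GE vE.
- by rewrite /prod_form /= /L2v_form /L2_form GE (wd _ tv) addNr.
- exact: nt Hv.
Qed.

Lemma H0div_val (h : H) :
  H0div Omega (sub_val (H0div_field h), sub_val (H0div_div h)).
Proof.
apply/H0div_subspaceP; have := sub_of_in h.
by rewrite /H0div_field /H0div_div; case: (sub_val h).
Qed.

Lemma H0div_lift s : H0div Omega s ->
  {h : H | (sub_val (H0div_field h), sub_val (H0div_div h)) = s}.
Proof.
move=> /[dup] Hs [[Ls Lg _] _].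
have [s' s'E] := L2v_lift Ls; have [g' g'E] := L2_lift Lg.
have [|h hE] := @sub_of_ex _ _ H0div_subspace (s', g').
  by apply/H0div_subspaceP; rewrite s'E g'E -surjective_pairing.
by exists h; rewrite /H0div_field /H0div_div hE s'E g'E -surjective_pairing.
Qed.

(** * From the abstract problem to functions on Omega *)

Section solution.
Variables (ell zeta kappa : R).
Hypotheses (z0 : 0 < zeta) (k0 : 0 < kappa) (k1 : kappa < 1).

Local Notation X := (dual_space U W H).
Local Notation gX := (dual_sip gU gW gH).
Local Notation B := (dual_form gU gW H0div_field H0div_div zeta kappa).

(** Forgets the membership proofs. By [raw_solution_lift] its range is all of Yd x Zd, so
    quantifiers over functions and over [X] can be exchanged. *)
Definition raw_solution (x : X) :=
  let: (u, e, s, (l, m)) := x in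
  ((sub_val u, sub_val e, (sub_val (H0div_field s), sub_val (H0div_div s))),
   (sub_val l, (sub_val (H0div_field m), sub_val (H0div_div m)))).

Definition raw_data (f : W * W * U) :=
  (sub_val f.1.1, sub_val f.1.2, sub_val f.2).

Definition data_form (f : W * W * U) (w : X) :=
  gW f.1.1 w.1.1.2 + kappa * gW f.1.2 (H0div_field w.1.2) + gU f.2 w.2.1.

Lemma raw_solution_Yd x : Yd Omega (raw_solution x).1.
Proof.
case: x => [[[u e] s] [l m]]; split; [exact: L2_val|exact: L2v_val|].
exact: H0div_val.
Qed.

Lemma raw_solution_Zd x : Zd Omega (raw_solution x).2.
Proof.
case: x => [[[u e] s] [l m]]; split; [exact: L2_val|exact: H0div_val].
Qed.

Lemma raw_solution_lift y z : Yd Omega y -> Zd Omega z ->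
  {x : X | raw_solution x = (y, z)}.
Proof.
case: y => [[u e] s]; case: z => [l m] [/= /L2_lift[u' <-] /L2v_lift[e' <-]].
move=> /H0div_lift[s' <-] [/= /L2_lift[l' <-] /H0div_lift[m' <-]].
by exists (u', e', s', (l', m')).
Qed.

Lemma raw_data_lift f : data_d Omega f -> {f' | raw_data f' = f}.
Proof.
case: f => [[e s] q] [/= /L2v_lift[e' <-] /L2v_lift[s' <-] /L2_lift[q' <-]].
by exists (e', s', q').
Qed.

Lemma a_dE x w : a_d Omega kappa (raw_solution x).1 (raw_solution w).1 =
  dual_a gW H0div_field kappa x.1 w.1.
Proof. by case: x w => [[[u e] s] [l m]] [[[u' e'] s'] [l' m']]. Qed.

Lemma b_dE x w : b_d Omega zeta (raw_solution x).1 (raw_solution w).2 =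
  dual_b gU gW H0div_field H0div_div zeta x.1 w.2.
Proof.
by case: x w => [[[u e] s] [l m]] [[[u' e'] s'] [l' m']].
Qed.

(** One identity carries both equations: they are separated by setting either the multiplier half or
    the primal half of the test vector to zero. *)
Lemma solution_dP f x : solution_d Omega zeta kappa (raw_data f) (raw_solution x) <->
  forall w, B x w = data_form f w.
Proof.
have solE : solution_d Omega zeta kappa (raw_data f) (raw_solution x) <->
  (forall w : X, dual_a gW H0div_field kappa x.1 w.1
    + dual_b gU gW H0div_field H0div_div zeta w.1 x.2 =
    gW f.1.1 w.1.1.2 + kappa * gW f.1.2 (H0div_field w.1.2)) /\
  (forall w : X, dual_b gU gW H0div_field H0div_div zeta x.1 w.2 = gU f.2 w.2.1).
  rewrite /solution_d /raw_data; have := raw_solution_Yd x; have := raw_solution_Zd x.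
  have aE := a_dE x; have bE := b_dE x; have bE' w := b_dE w x.
  case: (raw_solution x) aE bE bE' => y z /= aE bE bE' Zz Yy; split.
    move=> [_ _ h1 h2]; split => w.
      rewrite -aE -bE' h1; last exact: raw_solution_Yd.
      by case: w => [[[u e] s] [l m]].
    rewrite -bE h2; last exact: raw_solution_Zd.
    by case: w => [[[u e] s] [l m]].
  move=> [h1 h2]; split => // [dy Ydy|dz Zdz].
    have [w wE] := raw_solution_lift Ydy Zz.
    have -> : dy = (raw_solution w).1 by rewrite wE.
    by rewrite aE bE' h1; case: {wE} w => [[[u e] s] [l m]].
  have [w wE] := raw_solution_lift Yy Zdz.
  have -> : dz = (raw_solution w).2 by rewrite wE.
  by rewrite bE h2; case: {wE} w => [[[u e] s] [l m]].
rewrite solE; split=> [[h1 h2] w|h].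
  by rewrite /dual_form /data_form h1 h2.
have i0 : H0div_field 0 = 0 by rewrite /H0div_field sub_val0.
have d0 : H0div_div 0 = 0 by rewrite /H0div_div sub_val0.
split=> w.
  have := h (w.1, 0); rewrite /dual_form /data_form /dual_b.
  by rewrite ![(_, _).1]/= ![(_, _).2]/= i0 d0 !sip0l sip0r !addr0.
have := h (0, w.2); rewrite /dual_form /dual_a /data_form /dual_b.
rewrite ![(_, _).1]/= ![(_, _).2]/= i0 d0 scaler0 addr0 !sip0r mulr0 !addr0 !add0r.
by [].
Qed.

Lemma sqr_nrm f : nrm Omega f ^+ 2 = ip Omega f f.
Proof. by rewrite sqr_sqrtr ?ip_ge0. Qed.

Lemma sqr_nrmv (f : W) : nrmv Omega (sub_val f) ^+ 2 = gW f f.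
Proof. by rewrite sqr_sqrtr//; exact: sip_ge0 gW f. Qed.

Lemma sqr_norm_data f : norm_data_d Omega (raw_data f) ^+ 2 =
  gW f.1.1 f.1.1 + gW f.1.2 f.1.2 + gU f.2 f.2.
Proof.
rewrite /norm_data_d sqr_sqrtr /raw_data /= ?addr_ge0 ?sqr_ge0//.
by rewrite sqr_nrm !sqr_nrmv.
Qed.

Lemma data_form_bounded f w : data_form f w ^+ 2 <=
  3 * (1 + kappa ^+ 2) * norm_data_d Omega (raw_data f) ^+ 2 * gX w w.
Proof.
have ew : gW w.1.1.2 w.1.1.2 <= gX w w.
  case: w => [[[u' e'] s'] [l' m']]; rewrite dual_sipE [leLHS]/=.
  have := sip_ge0 gU u'; have := sip_ge0 gH s'; have := sip_ge0 gU l'.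
  by have := sip_ge0 gH m'; rewrite /=; lra.
have sw : gW (H0div_field w.1.2) (H0div_field w.1.2) <= gX w w.
  case: w {ew} => [[[u' e'] s'] [l' m']]; rewrite dual_sipE (H0div_sipE s') [leLHS]/=.
  have := sip_ge0 gU u'; have := sip_ge0 gW e'; have := sip_ge0 gU l'.
  by have := sip_ge0 gU (H0div_div s'); have := sip_ge0 gH m'; rewrite /=; lra.
have lw : gU w.2.1 w.2.1 <= gX w w.
  case: w {ew sw} => [[[u' e'] s'] [l' m']]; rewrite dual_sipE [leLHS]/=.
  have := sip_ge0 gU u'; have := sip_ge0 gH s'; have := sip_ge0 gW e'.
  by have := sip_ge0 gH m'; rewrite /=; lra.
rewrite sqr_norm_data; set N := gX w w in ew sw lw *.
have CS (V : lmodType R) (g : sip V) y :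
    g y y <= N -> forall x, g x y ^+ 2 <= g x x * N.
  by move=> yN x; rewrite (le_trans (sip_CS _ _ _))// ler_wpM2l ?sip_ge0.
have := CS _ _ _ lw f.2; have := CS _ _ _ sw f.1.2; have := CS _ _ _ ew f.1.1.
rewrite /data_form; move: (gW f.1.1 w.1.1.2) (gW f.1.2 _) (gU f.2 w.2.1) => a b c.
move: (gW f.1.1 _) (gW f.1.2 _) (gU f.2 _) => a' b' c' ha hb hc.
have k2 : 0 <= 3 * (1 + kappa ^+ 2) by rewrite mulr_ge0// addr_ge0// sqr_ge0.
(* The factor 3 comes from squaring a sum of three terms, and 1 + kappa^2 dominates both of the
   coefficients 1 and kappa^2. *)
rewrite (@le_trans _ _ (3 * (1 + kappa ^+ 2) * (a ^+ 2 + b ^+ 2 + c ^+ 2)))//.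
  have := sqr_ge0 (a - kappa * b); have := sqr_ge0 (kappa * b - c).
  have := sqr_ge0 (a - c); have := sqr_ge0 (kappa * a); have := sqr_ge0 (kappa * c).
  have := sqr_ge0 b; rewrite !exprMn; lra.
by rewrite -(mulrA (3 * _)) ler_wpM2l//; lra.
Qed.

Lemma sqr_norm_solution u e s l m :
  normXd Omega ell kappa (raw_solution (u, e, s, (l, m))) ^+ 2 =
  ell ^- 2 * gU u u + gW e e + kappa * gW (H0div_field s) (H0div_field s)
  + kappa * ell ^+ 2 * gU (H0div_div s) (H0div_div s)
  + (kappa^-1 * ell ^- 2 * gU l l + gW (H0div_field m) (H0div_field m)
     + ell ^+ 2 * gU (H0div_div m) (H0div_div m)).
Proof.
rewrite /normXd sqr_sqrtr ?addr_ge0 ?sqr_ge0// /raw_solution /normYd /normZd.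
have p2 (x : R) : 0 <= x ^+ 2 := sqr_ge0 x.
have ki : 0 <= kappa^-1 by rewrite invr_ge0 ltW.
have ei : 0 <= ell ^- 2 by rewrite invr_ge0.
have kk := ltW k0.
rewrite [X in X + _]sqr_sqrtr; last first.
  by do ?[exact: p2 | apply: addr_ge0 | apply: mulr_ge0].
rewrite [X in _ + X]sqr_sqrtr; last first.
  by do ?[exact: p2 | apply: addr_ge0 | apply: mulr_ge0].
by rewrite !sqr_nrm !sqr_nrmv.
Qed.

Lemma norm_solution_bounded : exists2 C : R, 0 <= C &
  forall x, normXd Omega ell kappa (raw_solution x) ^+ 2 <= C * gX x x.
Proof.
have p2 (x : R) : 0 <= x ^+ 2 := sqr_ge0 x.
have kk := ltW k0.
(* All weights of the two norms; being nonnegative, each is at most their sum [C]. *)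
pose p := [:: ell ^- 2; 1; kappa; kappa * ell ^+ 2; kappa^-1 * ell ^- 2; ell ^+ 2].
have p0 a : a \in p -> 0 <= a.
  rewrite !inE => /or4P[/eqP ->|/eqP ->|/eqP ->|/or3P[]/eqP ->] //.
  - by rewrite invr_ge0.
  - by rewrite mulr_ge0.
  - by rewrite mulr_ge0 ?invr_ge0.
pose C := \sum_(a <- p) a.
have le_C a b : a \in p -> 0 <= b -> a * b <= C * b.
  move=> ap b0; rewrite ler_wpM2r// /C (big_rem a ap) lerDl big_seq.
  by apply: sumr_ge0 => c cr; apply: p0; exact: mem_rem cr.
have C0 : 0 <= C by rewrite /C big_seq; apply: sumr_ge0 => a /p0.
exists C => // -[[[u e] s] [l m]]; rewrite sqr_norm_solution dual_sipE !H0div_sipE.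
have := le_C (ell ^- 2) _ _ (sip_ge0 gU u); have := le_C 1 _ _ (sip_ge0 gW e).
have := le_C kappa _ _ (sip_ge0 gW (H0div_field s)).
have := le_C (kappa * ell ^+ 2) _ _ (sip_ge0 gU (H0div_div s)).
have := le_C (kappa^-1 * ell ^- 2) _ _ (sip_ge0 gU l).
have := le_C 1 _ _ (sip_ge0 gW (H0div_field m)).
have := le_C (ell ^+ 2) _ _ (sip_ge0 gU (H0div_div m)).
rewrite /p !inE !eqxx !orbT => /(_ isT) h1 /(_ isT) h2 /(_ isT) h3 /(_ isT) h4.
move=> /(_ isT) h5 /(_ isT) h6 /(_ isT) h7; rewrite !mul1r in h2 h6.
by rewrite !mulrDr !addrA !lerD.
Qed.

Lemma dual_space_complete : sip_complete gX.
Proof.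
have cU : sip_complete gU by exact: L2_sip_complete.
have cW : sip_complete gW by exact: L2v_sip_complete.
have cH := H0div_sip_complete.
by do ?[apply: sip_prod_complete => //].
Qed.

Lemma data_form_linear f : linear_form (data_form f).
Proof.
move=> a x y; rewrite /data_form.
have -> : (a *: x + y).1.1.2 = a *: x.1.1.2 + y.1.1.2 by [].
have -> : (a *: x + y).1.2 = a *: x.1.2 + y.1.2 by [].
have -> : (a *: x + y).2.1 = a *: x.2.1 + y.2.1 by [].
by rewrite H0div_fieldP !sipDr !sipZr; ring.
Qed.

Lemma solution_exists f : exists x,
  solution_d Omega zeta kappa (raw_data f) (raw_solution x).
Proof.
have [|x xP] := dual_exists H0div_fieldP H0div_divP H0div_sipE z0 k0 k1
    dual_space_complete (data_form_linear f).
  exists (3 * (1 + kappa ^+ 2) * norm_data_d Omega (raw_data f) ^+ 2).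
    by apply: mulr_ge0; [rewrite mulr_ge0// addr_ge0// sqr_ge0|exact: sqr_ge0].
  by move=> w; exact: data_form_bounded.
by exists x; apply/solution_dP.
Qed.

Lemma solution_bounded : exists2 C : R, 0 <= C & forall f x,
  solution_d Omega zeta kappa (raw_data f) (raw_solution x) ->
  gX x x <= C * norm_data_d Omega (raw_data f) ^+ 2.
Proof.
have [C C0 CP] := dual_apriori H0div_fieldP H0div_divP H0div_sipE z0 k0 k1.
have K0 : 0 <= 3 * (1 + kappa ^+ 2) by rewrite mulr_ge0// addr_ge0// sqr_ge0.
exists (C * (3 * (1 + kappa ^+ 2))) => [|f x /solution_dP xP].
  by rewrite mulr_ge0.
rewrite -mulrA; apply: CP => [|w]; first by rewrite mulr_ge0 ?sqr_ge0.
by rewrite xP; exact: data_form_bounded.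
Qed.

Lemma dual_spaceB u e s l m u' e' s' l' m' :
  (u, e, s, (l, m)) - (u', e', s', (l', m')) =
  (u - u', e - e', s - s', (l - l', m - m')) :> X.
Proof. by []. Qed.

Lemma raw_solutionB x y : raw_solution (x - y) = raw_solution x - raw_solution y.
Proof.
case: x y => [[[u e] s] [l m]] [[[u' e'] s'] [l' m']].
by rewrite dual_spaceB /raw_solution !(H0div_fieldB, H0div_divB, sub_valB).
Qed.

Lemma raw_dataB f g : raw_data (f - g) = raw_data f - raw_data g.
Proof.
case: f g => [[e s] q] [[e' s'] q'].
have E : (e, s, q) - (e', s', q') = (e - e', s - s', q - q') :> W * W * U by [].
by rewrite {}E /raw_data ![(_, _).1]/= ![(_, _).2]/= !sub_valB.
Qed.

Lemma solutionB f f' x x' :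
  solution_d Omega zeta kappa (raw_data f) (raw_solution x) ->
  solution_d Omega zeta kappa (raw_data f') (raw_solution x') ->
  solution_d Omega zeta kappa (raw_data (f' - f)) (raw_solution (x' - x)).
Proof.
move=> /solution_dP xP /solution_dP xP'; apply/solution_dP => w.
have lin : linear_form (dual_form gU gW H0div_field H0div_div zeta kappa w).
  exact: dual_form_linear H0div_fieldP H0div_divP w.
rewrite dual_formC (_ : x' - x = -1 *: x + x'); last by rewrite scaleN1r addrC.
rewrite lin ![dual_form _ _ _ _ _ _ w _]dual_formC xP xP' mulN1r addrC.
case: f f' {xP xP'} => [[e s] q] [[e' s'] q'].
have E : (e', s', q') - (e, s, q) = (e' - e, s' - s, q' - q) :> W * W * U by [].
by rewrite {}E /data_form ![(_, _).1]/= ![(_, _).2]/= !sipBl; ring.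
Qed.

Lemma L2_sip_eq0 (f g : U) : gU (g - f) (g - f) = 0 ->
  eqL2 Omega (sub_val f) (sub_val g).
Proof.
move=> /(ip_eq0 mO (L2_val _)); apply: filterS => x h Ox.
have := h Ox; rewrite sub_valB => /eqP; rewrite subr_eq0 => /eqP h'.
exact: esym.
Qed.

Lemma L2v_sip_eq0 (f g : W) : gW (g - f) (g - f) = 0 ->
  eqL2v Omega (sub_val f) (sub_val g).
Proof.
rewrite /= (L2v_formE mO) => /eqP; rewrite psumr_eq0; last by move=> i _; exact: ip_ge0.
move=> /allP h; have {}h i :
    ae_eq leb Omega (fun x => sub_val (g - f) x ord0 i) (cst 0).
  have L2i : L2 Omega (fun x => sub_val (g - f) x ord0 i) by exact: L2v_val.
  by apply: (ip_eq0 mO L2i); apply/eqP/h; exact: mem_index_enum.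
have := filter_forall (ae_filter_ringOfSetsType leb) h.
apply: filterS => x hx Ox; apply/rowP => i.
have := hx i Ox; rewrite sub_valB /= fctE !mxE => /eqP; rewrite subr_eq0 => /eqP h'.
exact: esym.
Qed.

(** Null vectors of the semi-inner product vanish almost everywhere; this turns the a priori bound
    into uniqueness in the sense of [eqXd]. *)
Lemma dual_sip_eq0 x x' : gX (x' - x) (x' - x) = 0 ->
  eqXd Omega (raw_solution x) (raw_solution x').
Proof.
case: x x' => [[[u e] s] [l m]] [[[u' e'] s'] [l' m']].
rewrite dual_spaceB dual_sipE !H0div_sipE !(H0div_fieldB, H0div_divB) => /eqP.
do ![rewrite paddr_eq0 ?addr_ge0 ?sip_ge0//].
move=> /and3P[/andP[/andP[/eqP hu /eqP he] /andP[/eqP hs /eqP hds]]].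
move=> /eqP hl /andP[/eqP hm /eqP hdm].
split; [exact: L2_sip_eq0|exact: L2v_sip_eq0|split|exact: L2_sip_eq0|split].
- exact: L2v_sip_eq0.
- exact: L2_sip_eq0.
- exact: L2v_sip_eq0.
- exact: L2_sip_eq0.
Qed.

(** Uniqueness and continuity both rest on [solutionB]: the difference of two solutions solves the
    problem for the difference of the data, which is zero in one case and small in the other. *)
Lemma well_posed_dual : well_posed (data_d Omega) (solution_d Omega zeta kappa)
  (eqXd Omega) (norm_data_d Omega) (normXd Omega ell kappa).
Proof.
have lift f x : solution_d Omega zeta kappa f x -> {x' : X | raw_solution x' = x}.
  by case: f x => [[e s] q] [y z] [Yy Zz _ _]; exact: raw_solution_lift.
have [K K0 KP] := norm_solution_bounded; have [C C0 CP] := solution_bounded.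
split=> [_ /raw_data_lift[f <-]|_ _ /raw_data_lift[f <-] /[dup] /lift[x <-] xP eps e0].
  have [x xP] := solution_exists f; exists (raw_solution x) => //.
  move=> _ /[dup] /lift[x' <-] xP'.
  apply: dual_sip_eq0; apply/eqP; rewrite eq_le sip_ge0 andbT.
  rewrite (le_trans (CP _ _ (solutionB xP xP')))// subrr sqr_norm_data.
  by rewrite !sip0l !addr0 mulr0.
pose L := K * C; have L0 : 0 <= L by rewrite mulr_ge0.
(* [L] bounds squared norms; L <= (L + 1)^2 gives an admissible [delta] without a square root, and L
   + 1 is positive even when [L] is 0. *)
exists (eps / (L + 1)) => [|_ _ /raw_data_lift[f' <-] /[dup] /lift[x' <-] xP' hd].
  by rewrite divr_gt0// ltr_wpDl.
rewrite -raw_solutionB -raw_dataB in hd *.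
rewrite -ltr_sqr ?nnegrE ?sqrtr_ge0 ?(ltW e0)//.
rewrite (le_lt_trans (KP _))//.
rewrite (@le_lt_trans _ _ (L * norm_data_d Omega (raw_data (f' - f)) ^+ 2))//.
  by rewrite /L -mulrA ler_wpM2l// CP//; exact: solutionB xP xP'.
set D := norm_data_d _ _ in hd *.
have D0 : 0 <= D by exact: sqrtr_ge0.
rewrite ltr_pdivlMr in hd; last by rewrite ltr_wpDl.
have : (D * (L + 1)) ^+ 2 < eps ^+ 2.
  by rewrite ltr_sqr ?nnegrE ?mulr_ge0 ?addr_ge0// ltW.
apply: le_lt_trans; rewrite exprMn mulrC ler_wpM2l ?sqr_ge0//; nra.
Qed.

End solution.
End H0div_space.

Theorem theorem2 (R : realType) (d : nat) (hd : d = 2%N \/ d = 3%N)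
  (Omega : set 'rV[R]_d)
  (Omega_bounded : bounded_set Omega)
  (Omega_connected : connected Omega) (Omega_open : open Omega)
  (Omega_lipschitz : lipschitz_boundary Omega)
  (ell zeta : R) (ell_gt0 : 0 < ell) (zeta_gt0 : 0 < zeta) :
  exists2 kappa0 : R, 0 < kappa0 &
    forall kappa : R, 0 < kappa -> kappa < kappa0 ->
      well_posed (data_d Omega) (solution_d Omega zeta kappa) (eqXd Omega)
        (norm_data_d Omega) (normXd Omega ell kappa).
Proof.
have [M OM] := bounded_sub_cube Omega_bounded.
exists 1 => // kappa kappa_gt0 kappa_lt1.
exact: (well_posed_dual (measurable_open_row Omega_open) OM).
Qed.
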